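(* Fix an integer $d\ge 2$ and $\varepsilon>0$. There is a constant $C_{d,\varepsilon}>0$ (depending only on $d$ and $\varepsilon$) such that for every integer partition $\lambda=(\lambda_1,\ldots,\lambda_d)$ of $n$ with exactly $d$ parts and $\lambda_d\ge\varepsilon n$, we have $$\delta(P_\lambda)\le\frac{C_{d,\varepsilon}}{\sqrt n}.$$
   Context: For a finite poset $P=(X,\prec)$, a linear extension is an order-preserving bijection $L:X\to\{1,\ldots,|X|\}$. For distinct $x,y\in X$ let $\delta(P;x,y)=\bigl|\mathbf{P}[L(x)<L(y)]-\mathbf{P}[L(y)<L(x)]\bigr|$ with $L$ a uniformly random linear extension, and $\delta(P)=\min_{x\ne y}\delta(P;x,y)$. For a partition $\lambda$, $P_\lambda$ is the poset on the cells $(i,j)$, $1\le i\le \ell(\lambda)$, $1\le j\le\lambda_i$, of its Young diagram with $(i,j)\preceq(i',j')$ iff $i\le i'$ and $j\le j'$. *)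

(* Defs.v *)
From HB Require Import structures.
From mathcomp Require Import all_boot all_order all_algebra reals.

Set Implicit Arguments.
Unset Strict Implicit.
Unset Printing Implicit Defensive.

Import Order.TTheory GRing.Theory Num.Theory.
Local Open Scope ring_scope.

Section LinearExtensions.
Context {disp : Order.disp_t} (T : finPOrderType disp).

(* The labels {1, ..., |T|} are shifted to 'I_#|T| = {0, ..., |T| - 1};
   injectivity is bijectivity by cardinality (lin_extP). *)
Definition lin_ext : {set {ffun T -> 'I_#|T|}} :=
  [set L : {ffun T -> 'I_#|T|} |
    injectiveb L && [forall x, forall y, (x < y)%O ==> (L x < L y)%N]].

Lemma lin_extP (L : {ffun T -> 'I_#|T|}) :
  reflect (bijective L /\ forall x y, (x < y)%O -> (L x < L y)%N)
          (L \in lin_ext).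
Proof.
rewrite inE; apply: (iffP andP) => [[/injectiveP Li /forallP Lm]|[Lb Lm]].
  split; first by apply: inj_card_bij Li _; rewrite card_ord.
  by move=> x y xy; have /forallP/(_ y)/implyP := Lm x; apply.
split; first exact/injectiveP/bij_inj.
by apply/forallP => x; apply/forallP => y; apply/implyP/Lm.
Qed.

Variable R : realType.

Definition pr_lt (x y : T) : R :=
  #|[set L in lin_ext | (L x < L y)%N]|%:R / #|lin_ext|%:R.

Definition delta_pair (x y : T) : R := `|pr_lt x y - pr_lt y x|.

(* Every delta_pair is at most 1, so the default value 1 only matters when T
   has at most one element (see delta_min). *)
Definition delta : R :=
  \big[Num.min/1]_(p : T * T | p.1 != p.2) delta_pair p.1 p.2.

Lemma pr_lt_itv x y : 0 <= pr_lt x y <= 1.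
Proof.
rewrite /pr_lt divr_ge0 //=.
have [->|n0] := eqVneq #|lin_ext| 0%N; first by rewrite invr0 mulr0 ler01.
rewrite ler_pdivrMr ?ltr0n ?lt0n // mul1r ler_nat subset_leq_card //.
by apply/subsetP => L; rewrite inE => /andP[].
Qed.

Lemma delta_pair_le1 x y : delta_pair x y <= 1.
Proof.
have /andP[a0 a1] := pr_lt_itv x y; have /andP[b0 b1] := pr_lt_itv y x.
rewrite ler_norml lerNl opprB.
by rewrite -[1]subr0 !lerB.
Qed.

Lemma delta_min (x0 y0 : T) : x0 != y0 ->
  (exists x y, x != y /\ delta = delta_pair x y) /\
  (forall x y, x != y -> delta <= delta_pair x y).
Proof.
move=> xy0; split=> [|x y xy]; last exact: (@bigmin_le_cond _ _ _ _ (x, y)).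
rewrite /delta (@bigmin_eq_arg _ _ _ _ (x0, y0)) //; last first.
  by move=> p _; exact: delta_pair_le1.
by case: arg_minP => // -[x y] /= xy _; exists x, y.
Qed.

End LinearExtensions.

Definition is_partition (n : nat) (lam : seq nat) : bool :=
  [&& sorted geq lam, all (leq 1) lam & sumn lam == n].

(* Cells of the Young diagram, with rows and columns numbered from 0. A named
   type, because sigma types already carry a lexicographic order. *)
Definition young (lam : seq nat) : Type :=
  {i : 'I_(size lam) & 'I_(nth 0%N lam i)}.

Section YoungPoset.
Variable lam : seq nat.

HB.instance Definition _ := Finite.copy (young lam)
  {i : 'I_(size lam) & 'I_(nth 0%N lam i)}.

Definition young_row (c : young lam) : nat := tag c.
Definition young_col (c : young lam) : nat := tagged c.

Definition young_le (c c' : young lam) : bool :=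
  (young_row c <= young_row c')%N && (young_col c <= young_col c')%N.

Lemma young_le_refl : reflexive young_le.
Proof. by move=> c; rewrite /young_le !leqnn. Qed.

Lemma young_le_anti : antisymmetric young_le.
Proof.
move=> [i j] [i' j']; rewrite /young_le /young_row /young_col /=.
move=> /andP[/andP[ii' jj'] /andP[i'i j'j]].
have eq_i : i = i' by apply/val_inj/anti_leq; rewrite ii'.
case: _ / eq_i j' jj' j'j {ii' i'i} => j' jj' j'j.
by congr existT; apply/val_inj/anti_leq; rewrite jj'.
Qed.

Lemma young_le_trans : transitive young_le.
Proof.
move=> c2 c1 c3 /andP[r12 s12] /andP[r23 s23].
by rewrite /young_le (leq_trans r12 r23) (leq_trans s12 s23).
Qed.

Fact young_display : Order.disp_t. Proof. exact: Order.Disp tt tt. Qed.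

HB.instance Definition _ := Order.Le_isPOrder.Build young_display (young lam)
  young_le_refl young_le_anti young_le_trans.

End YoungPoset.

(* Main.v *)
(* The entries of a standard tableau of shape lambda are read off as the word of
   their rows. Only the first and the last row matter: call their letters stars,
   let k be half the number of stars, and let h be the number of last-row letters
   among the first k stars. If a + b = k + 1, the a-th cell of the first row
   precedes the b-th cell of the last row if and only if h < b. Taking b to be a
   median of h therefore bounds delta by twice the probability that h = b.

   Exchanging an early last-row letter with a later first-row letter preserves
   the ballot condition. Counting such exchanges shows that
   P[h = j - 1] >= (1 - O(1/sqrt n)) P[h = j] as long as j is at least
   lambda_d / 2 - O(sqrt n), so an atom there has mass O(1/sqrt n).

   That the median is at least lambda_d / 2 - O(sqrt n) follows from Chebyshev's
   inequality: the shape mu of the entries up to n/2 satisfies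
   E sum_i (mu_i - lambda_i / 2)^2 = O(n). This second moment is computed by
   removing the largest entry repeatedly; by the hook length formula row i
   loses the entry n with probability l_i w_i / n, where l_i = lambda_i + d - i and
   w_i = prod_(j <> i) (1 - 1 / (l_i - l_j)), and the power sums of the l_i
   weighted by the w_i follow from partial fractions. *)
Require Import Defs.
From mathcomp Require Import all_boot all_order all_algebra reals.
From mathcomp Require Import zify ring lra.
Import Order.TTheory GRing.Theory Num.Theory.
Local Open Scope ring_scope.

Set Implicit Arguments.
Unset Strict Implicit.
Unset Printing Implicit Defensive.

(** * Partial fraction weights *)

Section Weights.
Variable R : realFieldType.
Implicit Types (d : nat) (x g : nat -> R) (y : R).

(* The factor [j = i] equals [1], because [0^-1 = 0]. *)
Definition wt d x (i : nat) : R := \prod_(j < d) (1 - (x i - x j)^-1).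

Lemma wtS d x i : wt d.+1 x i = wt d x i * (1 - (x i - x d)^-1).
Proof. by rewrite /wt big_ord_recr. Qed.

Lemma wtSd d x : wt d.+1 x d = wt d x d.
Proof. by rewrite wtS subrr invr0 subr0 mulr1. Qed.

(** The shifted row lengths of a partition satisfy this; unit gaps keep the poles distinct and every
    factor of [wt] nonnegative. *)
Definition gapped d x := forall i j, (i < j < d)%N -> x j + 1 <= x i.

Lemma gappedS d x : gapped d.+1 x -> gapped d x.
Proof. by move=> H i j /andP[ij jd]; apply: H; rewrite ij ltnW. Qed.

Lemma gapped_sub_gt0 d x i : gapped d.+1 x -> (i < d)%N -> 0 < x i - x d.
Proof. by move=> gx id; have := gx i d; rewrite id ltnSn => /(_ isT); lra. Qed.

Lemma gapped_neq d x i : gapped d.+1 x -> (i < d)%N -> x d != x i.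
Proof. by move=> gx id; have := gapped_sub_gt0 gx id; rewrite eq_sym -subr_eq0; lra. Qed.

Lemma wt_ge0 d x i : gapped d x -> (i < d)%N -> 0 <= wt d x i.
Proof.
move=> gx id; apply: prodr_ge0 => j _.
have [ij|ji|->] := ltngtP i j; last by rewrite subrr invr0 subr0.
- have := gx i j; rewrite ij ltn_ord => /(_ isT) H.
  by rewrite subr_ge0 invf_le1; lra.
- have := gx j i; rewrite ji id => /(_ isT) H.
  have : (x i - x j)^-1 <= 0 by rewrite invr_le0; lra.
  by lra.
Qed.

(** The product is a rational function of [y] with value 1 at infinity and simple poles at the
    [x i], with residue [- wt d x i]. The induction hypothesis is used twice, at [y] and at
    [x d]. *)
Lemma prod_partial_fractions d x y : gapped d x ->
  (forall i, (i < d)%N -> y != x i) ->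
  \prod_(j < d) (1 - (y - x j)^-1) = 1 - \sum_(i < d) wt d x i / (y - x i).
Proof.
elim: d y => [|d IH] y dx yx; first by rewrite !big_ord0 subr0.
have dx' := gappedS dx.
rewrite !big_ord_recr /= wtSd IH //; last by move=> i id; exact/yx/ltnW.
rewrite [wt d x d]IH //; last by move=> i; exact: gapped_neq.
set s := \sum_(i < d) _ / _; set t := \sum_(i < d) _ / (x d - x _).
suff -> : \sum_(i < d) wt d.+1 x i / (y - x i) = s + (t - s) / (y - x d) by ring.
rewrite mulrBl !mulr_suml -sumrB -big_split; apply: eq_bigr => i _ /=.
have := gapped_neq dx (ltn_ord i); have := yx _ (ltnW (ltn_ord i)).
have := yx d (ltnSn d); rewrite wtS -![_ == x _]subr_eq0 => yd yi di.
by field; rewrite yi yd di -oppr_eq0 opprB di.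
Qed.

(** Expanding the new factor [1 - 1 / (x i - x d)], and [wt d x d] by partial fractions, leaves the
    divided differences of [g] at [x i] and [x d]. When [g] is a power of [x] these have lower
    degree, so weighted power sums follow by induction. *)
Lemma sum_wtS d x g : gapped d.+1 x ->
  \sum_(i < d.+1) g i * wt d.+1 x i = \sum_(i < d) g i * wt d x i + g d
    - \sum_(i < d) wt d x i * ((g i - g d) / (x i - x d)).
Proof.
move=> gx; rewrite big_ord_recr /= wtSd.
rewrite [wt d x d]prod_partial_fractions;
  [|exact: gappedS|by move=> i; exact: gapped_neq].
suff -> : \sum_(i < d) g i * wt d.+1 x i = \sum_(i < d) g i * wt d x i
    + g d * (\sum_(i < d) wt d x i / (x d - x i))
    - \sum_(i < d) wt d x i * ((g i - g d) / (x i - x d)) by ring.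
rewrite mulr_sumr -big_split -sumrB; apply: eq_bigr => i _ /=.
have := gapped_sub_gt0 gx (ltn_ord i); rewrite wtS => H.
have H' : x d - x i != 0 by lra.
by field; rewrite H' /=; lra.
Qed.

Lemma sum_wt0 d x : gapped d x -> \sum_(i < d) wt d x i = d%:R.
Proof.
elim: d => [|d IH] gx; first by rewrite big_ord0.
have := sum_wtS (fun=> 1) gx; under eq_bigr do rewrite mul1r.
under [X in _ = X + _ - _]eq_bigr do rewrite mul1r.
move=> ->; rewrite IH; last exact: gappedS.
by rewrite big1 ?subr0 ?natr1 // => i _; rewrite subrr mul0r mulr0.
Qed.

Lemma sum_wt1 d x : gapped d x ->
  \sum_(i < d) x i * wt d x i = \sum_(i < d) x i - 'C(d, 2)%:R.
Proof.
elim: d => [|d IH] gx; first by rewrite !big_ord0 subr0.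
have gx' := gappedS gx.
rewrite sum_wtS // IH // [X in _ + _ - X](eq_bigr (fun i : 'I_d => wt d x i));
  last first.
  by move=> i _; rewrite divff ?mulr1 // gt_eqF // gapped_sub_gt0.
by rewrite sum_wt0 // big_ord_recr binS bin1 natrD /=; ring.
Qed.

(** The divided difference of the square is [x i + x d], whose weighted sum is known exactly from
    [sum_wt1] and [sum_wt0]. Only a lower bound is kept: each step discards a nonnegative binomial
    term and one [x d]. *)
Lemma sum_wt2 d x : gapped d x -> (forall i, 0 <= x i) ->
  \sum_(i < d) x i ^+ 2 - d%:R * \sum_(i < d) x i
  <= \sum_(i < d) x i ^+ 2 * wt d x i.
Proof.
move=> + x0; elim: d => [|d IH] gx; first by rewrite !big_ord0 mulr0 subr0.
have gx' := gappedS gx.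
rewrite (sum_wtS (fun i => x i ^+ 2)) //.
rewrite [X in _ + _ - X](eq_bigr (fun i : 'I_d => x i * wt d x i + x d * wt d x i));
  last first.
  move=> i _; have := gapped_sub_gt0 gx (ltn_ord i) => H.
  by field; lra.
rewrite big_split /= -mulr_sumr sum_wt1 // sum_wt0 // !big_ord_recr /=.
have := IH gx'; have := ler0n R 'C(d, 2).
rewrite -natr1; have := x0 d; lra.
Qed.

(** The product [g i * x i] decreases with [i], so the divided differences in [sum_wtS] are
    nonnegative and the correction only lowers the sum. *)
Lemma sum_wt_decreasing d x g : gapped d x -> (forall i, 0 <= x i) ->
  (forall i, 0 <= g i) -> (forall i j, (i <= j)%N -> g j <= g i) ->
  \sum_(i < d) g i * x i * wt d x i <= \sum_(i < d) g i * x i.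
Proof.
move=> + x0 g0 gd; elim: d => [|d IH] gx; first by rewrite !big_ord0.
have gx' := gappedS gx.
rewrite (sum_wtS (fun i => g i * x i)) // big_ord_recr /= lerBlDr.
have IH' := IH gx'; apply: le_trans (lerD IH' (lexx _)) _; rewrite lerDl.
apply: sumr_ge0 => i _; apply: mulr_ge0; first exact: wt_ge0.
have H := gapped_sub_gt0 gx (ltn_ord i).
apply: divr_ge0; last exact: ltW.
by rewrite subr_ge0 ler_pM // ?gd ?(ltnW (ltn_ord i)) // -subr_ge0 ltW.
Qed.

Definition vdm d x : R := \prod_(j < d) \prod_(i < j) (x i - x j).

Lemma vdmS d x : vdm d.+1 x = vdm d x * \prod_(i < d) (x i - x d).
Proof. by rewrite /vdm big_ord_recr. Qed.

(** Lowering [x a] by one multiplies each Vandermonde factor involving [x a] and [x j] by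
    [1 - 1 / (x a - x j)], whether [j] comes before or after [a]. *)
Lemma vdm_shift d x a : gapped d x -> (a < d)%N ->
  vdm d (fun i => x i - (i == a)%:R) = vdm d x * wt d x a.
Proof.
elim: d => [//|d IH] gx; have gx' := gappedS gx.
rewrite ltnS leq_eqVlt !vdmS => /predU1P[->|ad].
  rewrite eqxx wtSd -mulrA /wt -[in RHS]big_split /=; congr (_ * _).
    apply: eq_bigr => j _; apply: eq_bigr => i _.
    by rewrite !ltn_eqF ?(ltn_trans (ltn_ord i)) ?subr0 // ltn_ord.
  apply: eq_bigr => i _; rewrite ltn_eqF ?ltn_ord // subr0.
  have := gapped_sub_gt0 gx (ltn_ord i) => H.
  have H' : x d - x i != 0 by lra.
  by field.
rewrite IH // wtS gtn_eqF // subr0.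
rewrite (bigD1 (Ordinal ad)) //= [in RHS](bigD1 (Ordinal ad)) //= eqxx.
rewrite (eq_bigr (fun i : 'I_d => x i - x d)) => [|i /negPf]; last first.
  by rewrite -val_eqE /= => ->; rewrite subr0.
by have H := gapped_sub_gt0 gx ad; rewrite mulr1n; field; lra.
Qed.

Lemma vdm_gt0 d x : gapped d x -> 0 < vdm d x.
Proof.
move=> gx; apply: prodr_gt0 => j _; apply: prodr_gt0 => i _.
by have := gx i j; rewrite !ltn_ord => /(_ isT); lra.
Qed.

End Weights.

(** * Ballot words *)

Section Words.
Variable d : nat.
Implicit Types (c : nat -> nat) (w : seq nat).

Definition dec c (i : nat) : nat -> nat := fun j => (c j - (j == i))%N.

Definition corner c (i : nat) := (c i.+1 < c i)%N.

(** Rows may be empty, so that the shapes obtained by removing entries stay in the class with the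
    same [d]. *)
Definition part c := (forall i, (c i.+1 <= c i)%N) /\ c d = 0%N.

Definition ballot w := forall t x,
  (count_mem x.+1 (take t w) <= count_mem x (take t w))%N.

(* A standard tableau is encoded by the word whose t-th letter is the row of
   the entry t; the rows are numbered from 0 and have lengths [c 0], [c 1], ... *)
Fixpoint words n c : seq (seq nat) :=
  if n is m.+1 then
    [seq rcons w i | i <- [seq i <- index_iota 0 d | corner c i],
                     w <- words m (dec c i)]
  else [:: [::]].

Lemma part_le c i j : part c -> (i <= j)%N -> (c j <= c i)%N.
Proof.
case=> cS _; elim: j => [|j IH]; first by rewrite leqn0 => /eqP->.
by rewrite leq_eqVlt => /predU1P[->//|ij]; apply: leq_trans (cS j) (IH ij).
Qed.

Lemma part_ge_eq0 c i : part c -> (d <= i)%N -> c i = 0%N.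
Proof. by move=> pc /(part_le pc); case: pc => _ ->; rewrite leqn0 => /eqP. Qed.

Lemma corner_lt c i : part c -> corner c i -> (i < d)%N.
Proof.
move=> pc; rewrite /corner; case: (ltnP i d) => // di.
by rewrite (part_ge_eq0 pc di) ltn0.
Qed.

Lemma corner_gt0 c i : corner c i -> (0 < c i)%N.
Proof. by rewrite /corner; case: (c i). Qed.

Lemma part_dec c i : part c -> corner c i -> part (dec c i).
Proof.
move=> pc ci; have id := corner_lt pc ci; case: (pc) => cS cd.
split=> [j|]; rewrite /dec ?cd ?sub0n //; move: ci (cS j); rewrite /corner.
by have [->|_] := eqVneq j i; rewrite ?subn0; lia.
Qed.

Lemma sum_dec n c i : (i < d)%N -> (0 < c i)%N ->
  (\sum_(j < d) c j = n.+1 -> \sum_(j < d) dec c i j = n)%N.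
Proof.
move=> id ci; rewrite (bigD1 (Ordinal id)) //= [in X in _ -> X](bigD1 (Ordinal id)) //=.
rewrite /dec eqxx [X in _ -> (_ + X)%N = _](eq_bigr (fun j : 'I_d => c j)).
  by lia.
by move=> j; rewrite -val_eqE /= => /negPf ->; rewrite subn0.
Qed.

(** Induction on the last letter [i]. The ballot condition just before it forces row [i] to be
    longer than row [i.+1], so [i] is a corner; conversely, appending a corner only creates one new
    prefix, the whole word, whose counts are the row lengths. *)
Lemma mem_words n c w : part c -> (\sum_(i < d) c i)%N = n ->
  w \in words n c <-> ballot w /\ forall x, count_mem x w = c x.
Proof.
elim: n c w => [|n IH] c w pc cn.
  have c0 x : c x = 0%N.
    case: (ltnP x d) => [xd|]; last exact: part_ge_eq0.
    by move/eqP: cn; rewrite sum_nat_eq0 => /forallP/(_ (Ordinal xd))/eqP.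
  rewrite inE; split=> [/eqP->|[_]]; first by split=> // x; rewrite c0.
  case: w => // a w /(_ a); rewrite c0 /= eqxx //.
split.
  case/allpairsPdep=> i [v [+ + ->]].
  rewrite mem_filter mem_index_iota => /andP[ci id] vw.
  have ci0 := corner_gt0 ci; have [] // := IH _ v (part_dec pc ci).
    exact: sum_dec.
  move=> /(_ vw) [bv cv] _.
  have cnt x : count_mem x (rcons v i) = c x.
    by rewrite -cats1 count_cat cv /= /dec addn0; case: eqVneq => [->|]; lia.
  split=> // t x; case: (leqP t (size v)) => tv.
    by rewrite -cats1 takel_cat.
  by rewrite take_oversize ?size_rcons // !cnt; case: pc.
case/lastP: w => [|v i] [bw cw].
  by move: cn; rewrite big1 // => j _; rewrite -cw.
have cv x : count_mem x v = dec c i x.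
  by rewrite /dec -cw -cats1 count_cat /= addn0 eq_sym addnK.
have bv : ballot v.
  move=> t x; case: (leqP t (size v)) => tv.
    by have := bw t x; rewrite -cats1 takel_cat.
  rewrite (take_oversize (ltnW tv)); have := bw (size v) x.
  by rewrite -cats1 takel_cat // take_size.
have ci : corner c i.
  have := bv (size v) i; rewrite take_size !cv /dec /corner -(cw i) -cats1 count_cat /= !eqxx.
  by rewrite eqn_leq ltnn; lia.
have id := corner_lt pc ci.
apply/allpairsPdep; exists i, v; split=> //.
  by rewrite mem_filter ci mem_index_iota.
by apply/IH => //; [exact: part_dec|exact/sum_dec/cn/corner_gt0].
Qed.

Lemma words_uniq n c : uniq (words n c).
Proof.
elim: n c => [//|n IH] c /=; apply: allpairs_uniq_dep => //.
  by rewrite filter_uniq // iota_uniq.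
by move=> [i v] [j w] _ _ /= /rcons_inj[-> ->].
Qed.

Lemma size_mem_words n c w : w \in words n c -> size w = n.
Proof.
elim: n c w => [|n IH] c w; first by rewrite inE => /eqP->.
by case/allpairsPdep=> i [v [_ /IH vn ->]]; rewrite size_rcons vn.
Qed.

Lemma big_words (R : zmodType) n c (phi : seq nat -> R) :
  \sum_(w <- words n.+1 c) phi w =
  \sum_(i < d | corner c i) \sum_(w <- words n (dec c i)) phi (rcons w i).
Proof. by rewrite big_allpairs_dep big_filter big_mkord. Qed.

End Words.

(** * The hook length formula for ballot words *)

Section HookFormula.
Variables (R : realFieldType) (d : nat).
Implicit Types (c : nat -> nat).

Definition ell c (i : nat) : R := (c i + (d - i.+1))%:R.

Lemma ell_ge0 c i : 0 <= ell c i. Proof. exact: ler0n. Qed.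

Lemma ell_gapped c : part d c -> gapped d (ell c).
Proof.
move=> pc i j /andP[ij jd]; rewrite /ell natr1 ler_nat.
by have := part_le pc (ltnW ij); lia.
Qed.

Lemma ell_dec c i : (0 < c i)%N -> ell (dec c i) =1 (fun j => ell c j - (j == i)%:R).
Proof.
move=> ci j; rewrite /ell /dec; case: eqVneq => [->|]; last by rewrite subn0 subr0.
have -> : (c i + (d - i.+1) = (c i - 1 + (d - i.+1)).+1)%N by lia.
by rewrite -[in RHS]natr1 addrK.
Qed.

(** Either row [i.+1] has the same length, and the gap 1 makes a factor of [wt] vanish, or [i] is
    the last row and is empty. Sums over corners thus extend to all rows. *)
Lemma ell_wt_eq0 c i : part d c -> (i < d)%N -> ~~ corner c i ->
  ell c i * wt d (ell c) i = 0.
Proof.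
move=> pc id; rewrite /corner -leqNgt => ci.
have {}ci : c i.+1 = c i by apply/eqP; rewrite eqn_leq ci (part_le pc).
case: (ltnP i.+1 d) => [id'|di]; last first.
  suff -> : ell c i = 0 by rewrite mul0r.
  by apply/eqP; rewrite /ell -ci (part_ge_eq0 pc di) pnatr_eq0; lia.
rewrite /wt (bigD1 (Ordinal id')) //= /ell ci -natrB; last by lia.
have -> : (c i + (d - i.+1) - (c i + (d - i.+2)))%N = 1%N by lia.
by rewrite invr1 subrr mul0r mulr0.
Qed.

(** Frobenius' form of the hook length formula: a Vandermonde product over factorials, without the
    factor [n!]. *)
Definition hook_prod c : R :=
  vdm d (ell c) / \prod_(i < d) (c i + (d - i.+1))`!%:R.

Lemma hook_prod_dec c i : part d c -> corner c i ->
  hook_prod (dec c i) = hook_prod c * (ell c i * wt d (ell c) i).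
Proof.
move=> pc ci; have id := corner_lt pc ci; have ci0 := corner_gt0 ci.
rewrite /hook_prod.
have -> : vdm d (ell (dec c i)) = vdm d (ell c) * wt d (ell c) i.
  rewrite -vdm_shift //; last exact: ell_gapped.
  by apply: eq_bigr => j _; apply: eq_bigr => k _; rewrite !ell_dec.
rewrite (bigD1 (Ordinal id)) //= [in RHS](bigD1 (Ordinal id)) //=.
rewrite [X in _ / (_ * X)](eq_bigr (fun j : 'I_d => (c j + (d - j.+1))`!%:R)).
  set P := \prod_(j < d | _) _.
  have P0 : P != 0.
    by rewrite prodf_seq_neq0; apply/allP => j _; rewrite pnatr_eq0 -lt0n fact_gt0 implybT.
  have -> : (c i + (d - i.+1))`! = ((c i + (d - i.+1)) * (dec c i i + (d - i.+1))`!)%N.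
    rewrite /dec eqxx; have -> : (c i + (d - i.+1) = (c i - 1 + (d - i.+1)).+1)%N by lia.
    by rewrite factS.
  rewrite natrM -/(ell c i); have l0 : ell c i != 0 by rewrite pnatr_eq0; lia.
  have f0 : (dec c i i + (d - i.+1))`!%:R != 0 :> R by rewrite pnatr_eq0 -lt0n fact_gt0.
  by field; rewrite f0 P0 -natrD.
by move=> j; rewrite -val_eqE /= /dec => /negPf ->; rewrite subn0.
Qed.

Lemma sum_ell c n : (\sum_(i < d) c i)%N = n ->
  \sum_(i < d) ell c i = n%:R + 'C(d, 2)%:R.
Proof.
move=> <-; rewrite -natrD /ell -natr_sum big_split /=; congr ((_ + _)%N%:R).
rewrite -bin2_sum big_mkord (reindex_inj rev_ord_inj) /=.
by apply: eq_bigr => i _; have := ltn_ord i; lia.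
Qed.

Lemma sum_ell_wt c n : part d c -> (\sum_(i < d) c i)%N = n ->
  \sum_(i < d) ell c i * wt d (ell c) i = n%:R.
Proof.
by move=> pc cn; rewrite sum_wt1 ?(sum_ell cn) ?addrK //; exact: ell_gapped.
Qed.

(** Both sides satisfy the same recursion under removal of a corner, because the factors
    [ell c i * wt d (ell c) i] sum to [n]. Dividing by the value at the empty shape avoids
    evaluating that value. *)
Lemma size_words c n : part d c -> (\sum_(i < d) c i)%N = n ->
  (size (words d n c))%:R = n`!%:R * hook_prod c / hook_prod (fun=> 0%N).
Proof.
have h0 : hook_prod (fun=> 0%N) != 0.
  apply: lt0r_neq0; apply: divr_gt0.
    by apply: vdm_gt0; apply: ell_gapped.
  by apply: prodr_gt0 => i _; rewrite ltr0n fact_gt0.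
elim: n c => [|n IH] c pc cn.
  have c0 x : c x = 0%N.
    case: (ltnP x d) => [xd|]; last exact: part_ge_eq0.
    by move/eqP: cn; rewrite sum_nat_eq0 => /forallP/(_ (Ordinal xd))/eqP.
  suff -> : hook_prod c = hook_prod (fun=> 0%N) by rewrite mul1r divff.
  rewrite /hook_prod; congr (_ / _).
    by apply: eq_bigr => j _; apply: eq_bigr => k _; rewrite /ell !c0.
  by apply: eq_bigr => j _; rewrite c0.
have sz v m : (size (words d m v))%:R = \sum_(w <- words d m v) (1 : R).
  by rewrite big_const_seq count_predT iter_addr_0.
rewrite sz big_words.
rewrite (eq_bigr (fun i : 'I_d => n`!%:R * (hook_prod c *
    (ell c i * wt d (ell c) i)) / hook_prod (fun=> 0%N))); last first.
  move=> i ci; rewrite -sz IH ?hook_prod_dec //; first exact: part_dec.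
  by apply: sum_dec cn; rewrite ?corner_gt0.
rewrite factS natrM -(sum_ell_wt pc cn) mulr_suml mulr_suml mulr_suml.
rewrite [RHS](bigID (fun i : 'I_d => corner c i)) /= [X in _ = _ + X]big1 ?addr0.
  by apply: eq_bigr => i _; ring.
by move=> i ci; rewrite ell_wt_eq0 // !mul0r.
Qed.

(** In probabilistic terms, the last letter of a uniform word is [i] with probability
    [ell c i * wt d (ell c) i / n.+1]. *)
Lemma size_words_dec c n i : part d c -> (\sum_(i < d) c i)%N = n.+1 ->
  corner c i ->
  (size (words d n (dec c i)))%:R * n.+1%:R =
  (size (words d n.+1 c))%:R * (ell c i * wt d (ell c) i).
Proof.
move=> pc cn ci; rewrite !size_words ?hook_prod_dec //; last 2 first.
- exact: part_dec.
- by apply: sum_dec cn; [exact: corner_lt ci|exact: corner_gt0].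
by rewrite factS natrM; ring.
Qed.

End HookFormula.

(** * The second moment of an intermediate shape *)

Section Moments.
Variables (R : realFieldType) (d : nat).
Implicit Types (c : nat -> nat) (w : seq nat).

Local Notation ellR := (@ell R d).
Local Notation num n c := ((size (words d n c))%:R : R).

(** Conditioning on the last letter: a bound [B i] on the mean after removing corner [i] is averaged
    with the probabilities from [size_words_dec]. *)
Lemma words_take_mean_le n m c (psi : seq nat -> R) (B : nat -> R) :
  part d c -> (\sum_(i < d) c i)%N = n.+1 -> (m <= n)%N ->
  (forall i, corner c i -> \sum_(w <- words d n (dec c i)) psi (take m w)
     <= num n (dec c i) * B i) ->
  \sum_(w <- words d n.+1 c) psi (take m w) <=
  num n.+1 c * (\sum_(i < d) ellR c i * wt d (ellR c) i * B i / n.+1%:R).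
Proof.
move=> pc cn mn HB; rewrite big_words mulr_sumr.
rewrite [leRHS](bigID (fun i : 'I_d => corner c i)) /= [X in _ <= _ + X]big1 ?addr0;
  last by move=> i ci; rewrite ell_wt_eq0 // !mul0r mulr0.
apply: ler_sum => i ci.
have -> : num n.+1 c * (ellR c i * wt d (ellR c) i * B i / n.+1%:R) =
          num n (dec c i) * B i.
  have n0 : n.+1%:R != 0 :> R by rewrite pnatr_eq0.
  apply: (mulIf n0); rewrite [RHS]mulrAC (size_words_dec _ pc cn ci).
  by rewrite -!mulrA mulVf // mulr1.
apply: le_trans (HB _ ci); rewrite le_eqVlt; apply/orP; left; apply/eqP.
apply: eq_big_seq => w ww; rewrite -cats1 takel_cat //.
by rewrite (size_mem_words ww).
Qed.

Lemma sum_words_le n c (psi : seq nat -> R) B : 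
  (forall w, w \in words d n c -> psi w <= B) ->
  \sum_(w <- words d n c) psi w <= num n c * B.
Proof.
move=> H; rewrite big_seq; apply: le_trans (ler_sum _ H) _; rewrite -big_seq.
by rewrite big_const_seq count_predT iter_addr_0 mulr_natl.
Qed.

Lemma sum_sqr_ell_dec c i : (i < d)%N -> (0 < c i)%N ->
  \sum_(j < d) ellR (dec c i) j ^+ 2 =
  \sum_(j < d) ellR c j ^+ 2 - 2 * ellR c i + 1.
Proof.
move=> id ci; rewrite (bigD1 (Ordinal id)) //= [in RHS](bigD1 (Ordinal id)) //=.
rewrite [X in _ + X = _](eq_bigr (fun j : 'I_d => ellR c j ^+ 2)) => [|j].
  by rewrite ell_dec // eqxx mulr1n; ring.
by rewrite ell_dec // -val_eqE /= => /negPf ->; rewrite subr0.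
Qed.

Lemma sum_lin_dec c i (g : nat -> R) : (i < d)%N -> (0 < c i)%N ->
  \sum_(j < d) g j * (dec c i j)%:R = \sum_(j < d) g j * (c j)%:R - g i.
Proof.
move=> id ci; rewrite (bigD1 (Ordinal id)) //= [in RHS](bigD1 (Ordinal id)) //=.
rewrite [X in _ + X = _](eq_bigr (fun j : 'I_d => g j * (c j)%:R)) => [|j].
  by rewrite /dec eqxx natrB // mulr1n; ring.
by rewrite /dec -val_eqE /= => /negPf ->; rewrite subn0.
Qed.

(** Chosen so that [N + 1 + 2 d (N + 1 + 'C(d, 2)) <= K (N + 1)], the left side being the error of
    one removal in the second moment recursion. *)
Let K : R := 1 + 2 * d%:R * (1 + 'C(d, 2)%:R).

(** Going from size [p] to [p - 1] multiplies the mean sum of squares by about [(p - 2) / p]. These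
    factors telescope to [m (m - 1) / (n (n - 1))], and the accumulated errors telescope to the term
    in [K]. *)
Lemma sum_sqr_shape_le m n c : part d c -> (\sum_(i < d) c i)%N = n ->
  (2 <= m <= n)%N ->
  \sum_(w <- words d n c) \sum_(i < d) ellR (fun i => count_mem i (take m w)) i ^+ 2
  <= num n c * (m%:R * (m%:R - 1) / (n%:R * (n%:R - 1)) * \sum_(i < d) ellR c i ^+ 2
       + K * (m%:R - m%:R * (m%:R - 1) / (n%:R - 1))).
Proof.
move=> pc cn /andP[m2 mn]; rewrite -(subnKC mn) in cn *.
move: (n - m)%N c pc cn => t {mn}; elim: t => [|t IH] c pc cn.
  rewrite addn0 in cn *; apply: sum_words_le => w ww.
  have wm := size_mem_words ww; rewrite take_oversize ?wm //.
  have [_ cw] := (mem_words _ pc cn).1 ww.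
  have M1 : 2 <= m%:R :> R by rewrite (ler_nat R 2).
  have M0 : m%:R != 0 :> R by apply: lt0r_neq0; lra.
  have M0' : m%:R - 1 != 0 :> R by apply: lt0r_neq0; lra.
  rewrite divff ?mul1r; last exact: mulf_neq0.
  rewrite mulfK //.
  rewrite (subrr m%:R) mulr0 addr0 le_eqVlt; apply/orP; left; apply/eqP.
  by apply: eq_bigr => i _; rewrite /ell cw.
rewrite addnS in cn *; set n' := (m + t)%N in cn IH *.
have M2 : 2 <= m%:R :> R by rewrite (ler_nat R 2).
have N2 : 2 <= n'%:R :> R by rewrite (ler_nat R 2) (leq_trans m2) // leq_addr.
set S := \sum_(i < d) ellR c i ^+ 2.
set M := m%:R in M2 *; set N := n'%:R in N2 *.
pose al := M * (M - 1) / (N * (N - 1)).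
pose be := K * (M - M * (M - 1) / (N - 1)).
apply: le_trans (words_take_mean_le (psi := fun v => \sum_(i < d)
  ellR (fun i => count_mem i v) i ^+ 2)
  (B := fun i => al * (S - 2 * ellR c i + 1) + be) pc cn (leq_addr _ _) _) _.
  move=> i ci; have id := corner_lt pc ci; have ci0 := corner_gt0 ci.
  rewrite -(sum_sqr_ell_dec id ci0); apply: IH; first exact: part_dec.
  exact: sum_dec cn.
apply: ler_wpM2l => //.
have g := ell_gapped R pc.
have s2 := sum_wt2 g (ell_ge0 R d c); rewrite (sum_ell R cn) -/S in s2.
have s1 := sum_ell_wt R pc cn.
rewrite -natr1 -/N in s1 s2 *.
set S2 := \sum_(i < d) ellR c i ^+ 2 * _ in s2.
rewrite -mulr_suml.
have -> : \sum_(i < d) ellR c i * wt d (ellR c) i * (al * (S - 2 * ellR c i + 1) + be)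
  = (al * (S + 1) + be) * (N + 1) - 2 * al * S2.
  rewrite -s1 !mulr_sumr -sumrB; apply: eq_bigr => i _; ring.
have al0 : 0 <= al by apply: divr_ge0; apply: mulr_ge0; lra.
have -> : M * (M - 1) / ((N + 1) * (N + 1 - 1)) = al * ((N - 1) / (N + 1)).
  by rewrite /al; field; do ?(apply/andP; split); apply: lt0r_neq0; lra.
have -> : K * (M - M * (M - 1) / (N + 1 - 1)) = be + K * al.
  by rewrite /be /al; field; do ?(apply/andP; split); apply: lt0r_neq0; lra.
rewrite ler_pdivrMr; last by lra.
have -> : (al * ((N - 1) / (N + 1)) * S + (be + K * al)) * (N + 1) =
  al * ((N - 1) * S + K * (N + 1)) + be * (N + 1).
  by field; apply: lt0r_neq0; lra.
suff : al * ((S + 1) * (N + 1) - 2 * S2) <= al * ((N - 1) * S + K * (N + 1)).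
  by lra.
apply: ler_wpM2l => //.
have : 0 <= d%:R * 'C(d, 2)%:R * N :> R by rewrite !mulr_ge0 //; lra.
by rewrite /K; lra.
Qed.

(** Here one removal contributes the factor [(p - 1) / p], with product [m / n]; [K'] pays for
    replacing [c] by [ell] in [sum_wt_decreasing]. Signs are reversed in the proof so that the upper
    bound [words_take_mean_le] applies. *)
Lemma sum_lin_shape_ge m n c (g : nat -> R) (K' : R) :
  part d c -> (\sum_(i < d) c i)%N = n -> (1 <= m <= n)%N ->
  (forall i, 0 <= g i) -> (forall i j, (i <= j)%N -> g j <= g i) ->
  \sum_(i < d) g i * (d - i.+1)%:R <= K' ->
  num n c * (m%:R / n%:R * \sum_(i < d) g i * (c i)%:R - K' * (1 - m%:R / n%:R))
  <= \sum_(w <- words d n c) \sum_(i < d) g i * (count_mem (i : nat) (take m w))%:R.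
Proof.
move=> pc cn /andP[m1 mn] g0 gd gK; rewrite -(subnKC mn) in cn *.
rewrite -lerN2 -mulrN -sumrN.
move: (n - m)%N c pc cn => t {mn}; elim: t => [|t IH] c pc cn.
  rewrite addn0 in cn *; apply: sum_words_le => w ww.
  have wm := size_mem_words ww; rewrite take_oversize ?wm //.
  have [_ cw] := (mem_words _ pc cn).1 ww.
  have M1 : 1 <= m%:R :> R by rewrite (ler_nat R 1).
  rewrite divff ?mul1r; last by apply: lt0r_neq0; lra.
  rewrite subrr mulr0 subr0 lerN2 le_eqVlt; apply/orP; left; apply/eqP.
  by apply: eq_bigr => i _; rewrite cw.
rewrite addnS in cn *; set n' := (m + t)%N in cn IH *.
have M1 : 1 <= m%:R :> R by rewrite (ler_nat R 1).
have N1 : 1 <= n'%:R :> R by rewrite (ler_nat R 1) (leq_trans m1) // leq_addr.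
set S := \sum_(i < d) g i * (c i)%:R.
set M := m%:R in M1 *; set N := n'%:R in N1 *.
apply: le_trans (words_take_mean_le (psi := fun v => - \sum_(i < d)
  g i * (count_mem (i : nat) v)%:R)
  (B := fun i => - (M / N * (S - g i) - K' * (1 - M / N))) pc cn (leq_addr _ _) _) _.
  move=> i ci; have id := corner_lt pc ci; have ci0 := corner_gt0 ci.
  rewrite -(sum_lin_dec g id ci0); apply: IH; first exact: part_dec.
  exact: sum_dec cn.
apply: ler_wpM2l => //.
have gp := ell_gapped R pc.
have s2 := sum_wt_decreasing gp (ell_ge0 R d c) g0 gd.
have s1 := sum_ell_wt R pc cn.
rewrite -natr1 -/N in s1 *.
have gS : \sum_(i < d) g i * ellR c i <= S + K'.
  apply: le_trans (lerD (lexx S) gK); rewrite -big_split /= ler_sum // => i _.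
  by rewrite /ell natrD mulrDr.
set S2 := \sum_(i < d) g i * ellR c i * _ in s2.
rewrite -mulr_suml.
have -> : \sum_(i < d) ellR c i * wt d (ellR c) i * - (M / N * (S - g i) - K' * (1 - M / N))
  = - (M / N * S - K' * (1 - M / N)) * (N + 1) + M / N * S2.
  set A := - (M / N * S - _); rewrite -s1 !mulr_sumr -big_split.
  by apply: eq_bigr => i _ /=; rewrite /A; ring.
rewrite ler_pdivrMr; last by lra.
have h : M / N * S2 <= M / N * (S + K').
  apply: ler_wpM2l; first by apply: divr_ge0; lra.
  exact: le_trans s2 gS.
apply: le_trans (lerD (lexx _) h) _.
rewrite le_eqVlt; apply/orP; left; apply/eqP.
by field; apply/andP; split; apply: lt0r_neq0; lra.
Qed.

Definition moment_const : R := 4 * d%:R + d%:R ^+ 3 + K.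

Lemma moment_const_gt0 : 0 < moment_const.
Proof.
rewrite /moment_const /K; have := ler0n R d; have := ler0n R 'C(d, 2) => a b.
have : 0 <= d%:R * 'C(d, 2)%:R :> R by rewrite mulr_ge0.
have : 0 <= d%:R ^+ 3 :> R by rewrite exprn_ge0.
by lra.
Qed.

(** After expanding the square, [sum_sqr_shape_le] bounds the quadratic part and [sum_lin_shape_ge]
    with [g i = c i] the cross term. The terms in [s ^+ 2 * C2] cancel, and what remains is linear
    in [n]. *)
Lemma shape_second_moment m n c : part d c -> (\sum_(i < d) c i)%N = n ->
  (2 <= m <= n)%N ->
  \sum_(w <- words d n c) \sum_(i < d)
    ((count_mem (i : nat) (take m w))%:R - m%:R / n%:R * (c i)%:R) ^+ 2
  <= num n c * (moment_const * n%:R).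
Proof.
move=> pc cn mn; have /andP[m2 mn'] := mn.
have M2 : 2 <= m%:R :> R by rewrite (ler_nat R 2).
have MN : m%:R <= n%:R :> R by rewrite ler_nat.
have cR : \sum_(i < d) (c i)%:R = n%:R :> R by rewrite -natr_sum cn.
have dle i : (d - i.+1)%:R <= d%:R :> R by rewrite ler_nat leq_subr.
have sq := sum_sqr_shape_le pc cn mn.
have li : num n c * (m%:R / n%:R * \sum_(i < d) (c i)%:R * (c i)%:R
    - d%:R * n%:R * (1 - m%:R / n%:R)) <= \sum_(w <- words d n c)
    \sum_(i < d) (c i)%:R * (count_mem (i : nat) (take m w))%:R.
  apply: (@sum_lin_shape_ge m n c (fun i => (c i)%:R)) => //.
  - by rewrite mn' (leq_trans _ m2).
  - by move=> i j ij; rewrite ler_nat (part_le pc).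
  - by rewrite -cR mulr_sumr ler_sum // => i _; rewrite mulrC ler_wpM2r.
set s := m%:R / n%:R in li *; set f := num n c in sq li *.
have s01 : 0 <= s <= 1.
  by rewrite /s divr_ge0 //= ler_pdivrMr ?mul1r //; lra.
have numE X : f * X = \sum_(w <- words d n c) X.
  by rewrite big_const_seq count_predT iter_addr_0 mulr_natl.
set L := \sum_(w <- _) \sum_(i < d) _ in li.
set Q := \sum_(w <- _) \sum_(i < d) _ in sq.
set C2 := \sum_(i < d) (c i)%:R * (c i)%:R in li.
set S := \sum_(i < d) ellR c i ^+ 2 in sq.
have SC : S <= C2 + 2 * d%:R * n%:R + d%:R ^+ 3.
  have -> : d%:R ^+ 3 = \sum_(i < d) d%:R ^+ 2 :> R.
    by rewrite big_const_ord iter_addr_0 exprSr mulr_natr.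
  rewrite -cR mulr_sumr -!big_split; apply: ler_sum => i _ /=.
  rewrite /ell natrD sqrrD -expr2 mulr2n.
  have h1 : (c i)%:R * (d - i.+1)%:R <= (c i)%:R * d%:R :> R.
    exact: ler_wpM2l.
  have h2 : (d - i.+1)%:R ^+ 2 <= d%:R ^+ 2 :> R by rewrite lerXn2r ?nnegrE.
  by lra.
have -> : \sum_(w <- words d n c) \sum_(i < d)
    ((count_mem (i : nat) (take m w))%:R - s * (c i)%:R) ^+ 2 =
  \sum_(w <- words d n c) \sum_(i < d) (count_mem (i : nat) (take m w))%:R ^+ 2
    - 2 * s * L + f * (s ^+ 2 * C2).
  rewrite numE mulr_sumr -sumrB -big_split; apply: eq_bigr => w _ /=.
  rewrite !mulr_sumr -sumrB -big_split; apply: eq_bigr => i _ /=; ring.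
have QQ : \sum_(w <- words d n c)
    \sum_(i < d) (count_mem (i : nat) (take m w))%:R ^+ 2 <= Q.
  apply: ler_sum => w _; apply: ler_sum => i _.
  by rewrite lerXn2r ?nnegrE ?ell_ge0 // ler_nat leq_addr.
have al : m%:R * (m%:R - 1) / (n%:R * (n%:R - 1)) <= s ^+ 2.
  rewrite -mulf_div expr2 ler_wpM2l //; first by case/andP: s01.
  rewrite /s ler_pdivrMr; last by lra.
  by rewrite mulrAC ler_pdivlMr; lra.
have al0 : 0 <= m%:R * (m%:R - 1) / (n%:R * (n%:R - 1)) :> R.
  by apply: divr_ge0; apply: mulr_ge0; lra.
set a := _ / (_ * _) in sq al al0.
have d0 := ler0n R d; have d3 : 0 <= d%:R ^+ 3 :> R by rewrite exprn_ge0.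
have dn0 : 0 <= d%:R * n%:R :> R by rewrite mulr_ge0.
have s1 : s ^+ 2 <= 1 by rewrite expr_le1; case/andP: s01.
have S0 : 0 <= S by apply: sumr_ge0 => i _; rewrite exprn_ge0 ?ell_ge0.
have aS : a * S <= s ^+ 2 * C2 + 2 * d%:R * n%:R + d%:R ^+ 3.
  apply: le_trans (ler_pM al0 S0 al SC) _; rewrite -addrA mulrDr -addrA lerD2l.
  by rewrite ler_piMl //; lra.
have K0 : 0 <= K.
  by rewrite /K addr_ge0 // !mulr_ge0 // addr_ge0.
have b0 : 0 <= m%:R * (m%:R - 1) / (n%:R - 1) :> R.
  by apply: divr_ge0; [apply: mulr_ge0|]; lra.
have f0 : 0 <= f by exact: ler0n.
have sL : s * (f * (s * C2 - d%:R * n%:R * (1 - s))) <= s * L.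
  by apply: ler_wpM2l li; case/andP: s01.
suff : f * (a * S + K * (m%:R - m%:R * (m%:R - 1) / (n%:R - 1))
       - 2 * s * (s * C2 - d%:R * n%:R * (1 - s)) + s ^+ 2 * C2)
     <= f * (moment_const * n%:R) by lra.
apply: ler_wpM2l => //.
have Kb : K * (m%:R - m%:R * (m%:R - 1) / (n%:R - 1)) <= K * n%:R.
  by apply: ler_wpM2l => //; lra.
have sd : s * (d%:R * n%:R * (1 - s)) <= d%:R * n%:R.
  have /andP[h0 h1] := s01.
  have : s * (1 - s) <= 1 by nra.
  by move=> /(ler_wpM2l dn0); lra.
have d3n : d%:R ^+ 3 <= d%:R ^+ 3 * n%:R :> R by rewrite ler_peMr //; lra.
by rewrite /moment_const; lra.
Qed.

End Moments.

(** * Exchanging letters of the first and the last row *)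

Section Swap.
Local Open Scope nat_scope.
Variables (e k : nat).
Hypothesis e_gt0 : 0 < e.
Implicit Types (w : seq nat).

Definition star : pred nat := fun x => (x == 0) || (x == e).

Definition early w := take k (filter star w).

Definition rank w r := count star (take r w).

Lemma count_take_sum (a : pred nat) w t : t <= size w ->
  count a (take t w) = \sum_(0 <= r < t) a (nth 0 w r).
Proof.
elim: t => [|t IH] tw; first by rewrite take0 big_nil.
by rewrite (take_nth 0) // -cats1 count_cat IH 1?ltnW // big_nat_recr //= addn0.
Qed.

Lemma count_early (a : pred nat) w :
  count a (early w) =
  \sum_(0 <= r < size w) (a (nth 0 w r) && star (nth 0 w r) && (rank w r < k)).
Proof.
suff H t : t <= size w -> count a (take k (filter star (take t w))) =
    \sum_(0 <= r < t) (a (nth 0 w r) && star (nth 0 w r) && (rank w r < k)).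
  by rewrite -H // take_size.
elim: t => [|t IH] tw; first by rewrite take0 big_nil.
rewrite (take_nth 0) // big_nat_recr //= -(IH (ltnW tw)) filter_rcons.
rewrite /rank -(size_filter star); set v := filter star (take t w); set x := nth 0 w t.
case: (star x); last by rewrite andbF /= addn0.
rewrite andbT -cats1 take_cat; case: ltnP => [kv|vk].
  by rewrite ltnNge (ltnW kv) andbF addn0.
rewrite count_cat (take_oversize vk); congr (_ + _).
case: ltnP => [vk'|kv]; first by rewrite take_oversize ?subn_gt0 //= addn0 andbT.
have -> : k - size v = 0 by apply/eqP; rewrite subn_eq0.
by rewrite andbF.
Qed.

Lemma count_star (w : seq nat) : count star w = count_mem 0 w + count_mem e w.
Proof.
elim: w => //= x w ->; rewrite /star.
by case: eqVneq => [->|_] /=; rewrite ?(gtn_eqF e_gt0) //=; lia.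
Qed.

Lemma count_early_star w : count_mem 0 (early w) + count_mem e (early w) =
  minn k (count star w).
Proof.
rewrite -count_star /early -(size_filter star w) -size_take_min; apply/eqP.
rewrite -all_count; apply/allP => x /mem_take.
by rewrite mem_filter => /andP[].
Qed.

Lemma leq_count_take (a : pred nat) w s t : s <= t ->
  count a (take s w) <= count a (take t w).
Proof.
by move=> st; rewrite -(cat_take_drop s (take t w)) count_cat take_takel // leq_addr.
Qed.

(** If the first [m] letters contain more than [k] stars, they include the first [k] stars, at least
    [k - z] of which are [x]. Otherwise all their letters [y] are among the first [k] stars. *)
Lemma early_or x y w m z : star x -> star y -> x != y ->
  k <= count star w -> count_mem y (early w) <= z ->
  k <= count_mem x (take m w) + z \/ count_mem y (take m w) <= z.
Proof.
move=> sx sy xy.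
have E u : star u -> forall v, count_mem u (filter star v) = count_mem u v.
  move=> su v; rewrite count_filter; apply: eq_count => u' /=.
  by case: eqVneq => // ->; rewrite su.
have sxy v : count star v = count_mem x v + count_mem y v.
  rewrite count_star; move: sx sy xy; rewrite /star.
  by do 2 case/predU1P=> [->|/eqP ->] //; rewrite ?eqxx // addnC.
rewrite -(E x sx (take m w)) -(E y sy (take m w)).
rewrite /early -{1 2}(cat_take_drop m w) filter_cat => kw.
set v := filter star (take m w); rewrite take_cat; case: ltnP => [kv|vk] H.
  left; have := count_cat (pred1 x) (take k v) (drop k v); rewrite cat_take_drop.
  suff : count star (take k v) = k by rewrite sxy; lia.
  rewrite -[RHS](size_takel (ltnW kv)); apply/eqP; rewrite -all_count.
  by apply/allP => u /mem_take; rewrite mem_filter => /andP[].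
by right; move: H; rewrite count_cat; lia.
Qed.

(** This is an exchange only when [w] has [e] at [p] and [0] at [q], as in all uses below. *)
Definition swap w p q :=
  mkseq (fun r => if r == p then 0 else if r == q then e else nth 0 w r) (size w).

Lemma size_swap w p q : size (swap w p q) = size w.
Proof. exact: size_mkseq. Qed.

Lemma nth_swap w p q r : r < size w -> nth 0 (swap w p q) r =
  if r == p then 0 else if r == q then e else nth 0 w r.
Proof. by move=> rw; rewrite nth_mkseq. Qed.

(** Stated additively to avoid truncated subtraction. Weight 1 gives prefix counts; the indicator of
    [rank w r < k] gives counts among the early stars. *)
Lemma wsum_swap w p q (g : nat -> nat) x t :
  p != q -> nth 0 w p = e -> nth 0 w q = 0 -> t <= size w ->
  \sum_(0 <= r < t) g r * (nth 0 (swap w p q) r == x)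
    + (g p * (p < t) * (e == x) + g q * (q < t) * (0 == x)) =
  \sum_(0 <= r < t) g r * (nth 0 w r == x)
    + (g p * (p < t) * (0 == x) + g q * (q < t) * (e == x)).
Proof.
move=> pq wp wq; elim: t => [|t IH] tw; first by rewrite !big_nil !ltn0 !muln0.
move: (IH (ltnW tw)); rewrite !big_nat_recr //= nth_swap // !ltnS.
rewrite (leq_eqVlt p t) (leq_eqVlt q t).
have [->|tp] := eqVneq t p; first by rewrite ?eqxx ?(eq_sym q p) (negPf pq) ltnn wp /=; lia.
have [->|tq] := eqVneq t q; first by rewrite ?eqxx ?(negPf pq) ltnn wq /=; lia.
by move=> /=; lia.
Qed.

Lemma count_take_swap w p q x t :
  p != q -> nth 0 w p = e -> nth 0 w q = 0 -> t <= size w ->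
  count_mem x (take t (swap w p q)) + ((p < t) * (e == x) + (q < t) * (0 == x)) =
  count_mem x (take t w) + ((p < t) * (0 == x) + (q < t) * (e == x)).
Proof.
move=> pq wp wq tw; rewrite !count_take_sum ?size_swap //=.
have := wsum_swap (fun=> 1) x pq wp wq tw.
rewrite !mul1n; under eq_bigr do rewrite mul1n.
by under [in X in _ = X -> _]eq_bigr do rewrite mul1n.
Qed.

Lemma rank_swap w p q t :
  p != q -> nth 0 w p = e -> nth 0 w q = 0 -> t <= size w ->
  rank (swap w p q) t = rank w t.
Proof.
move=> pq wp wq tw; rewrite /rank !count_star.
have := count_take_swap 0 pq wp wq tw; have := count_take_swap e pq wp wq tw.
by rewrite !eqxx (gtn_eqF e_gt0) (ltn_eqF e_gt0) !muln0 !muln1 !addn0; lia.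
Qed.

Lemma rank_lt w p q : rank w p < rank w q -> p < q.
Proof.
by rewrite ltnNge; case: (ltnP p q) => // qp; rewrite leq_count_take.
Qed.

Lemma count_e_early w : count_mem e (early w) =
  \sum_(0 <= r < size w) (rank w r < k) * (nth 0 w r == e).
Proof.
rewrite count_early; apply: eq_bigr => r _ /=.
case: eqVneq => [->|_]; last by rewrite muln0.
by rewrite /star eqxx orbT muln1.
Qed.

Lemma count_0_early w : count_mem 0 (early w) =
  \sum_(0 <= r < size w) (rank w r < k) * (nth 0 w r == 0).
Proof.
rewrite count_early; apply: eq_bigr => r _ /=.
by case: eqVneq => [->|_]; rewrite ?muln0 ?muln1.
Qed.

Lemma count_late w x : \sum_(0 <= r < size w) (k <= rank w r) * (nth 0 w r == x) =
  count_mem x w - \sum_(0 <= r < size w) (rank w r < k) * (nth 0 w r == x).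
Proof.
have -> : count_mem x w = \sum_(0 <= r < size w) (nth 0 w r == x).
  by rewrite -{1}(take_size w) count_take_sum.
rewrite [X in _ = X - _](eq_bigr (fun r => (k <= rank w r) * (nth 0 w r == x) +
    (rank w r < k) * (nth 0 w r == x))) => [|r _].
  by rewrite big_split /= addnK.
by rewrite -mulnDl; case: ltnP => _; rewrite mul1n.
Qed.

Lemma swap_early w p q : p != q -> nth 0 w p = e -> nth 0 w q = 0 ->
  p < size w -> q < size w -> rank w p < k -> k <= rank w q ->
  (count_mem e (early (swap w p q))).+1 = count_mem e (early w).
Proof.
move=> pq wp wq pw qw rp rq; rewrite !count_e_early size_swap.
rewrite [in LHS]big_nat (eq_bigr (fun r => (rank w r < k) * (nth 0 (swap w p q) r == e))).
  rewrite -big_nat.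
  have := wsum_swap (fun r => nat_of_bool (rank w r < k)) e pq wp wq (leqnn _).
  by rewrite rp pw qw ltnNge rq eqxx (ltn_eqF e_gt0) /= !muln0 !addn0 addn1.
by move=> r /andP[_ rw]; rewrite rank_swap // ltnW.
Qed.

(** On prefixes containing [p] but not [q] the count of [0] rises and that of [e] falls. Only the
    comparison of [e] with [e.+1] could fail, and [e.+1] does not occur. *)
Lemma swap_ballot w p q : ballot w -> count_mem e.+1 w = 0 ->
  nth 0 w p = e -> nth 0 w q = 0 -> p < q -> p < size w -> q < size w ->
  ballot (swap w p q).
Proof.
move=> bw ce wp wq pq pw qw t x; have pq' : p != q by rewrite ltn_eqF.
wlog tw : t / t <= size w => [H|].
  case: (leqP t (size w)) => [|wt]; first exact: H.
  by have := H (size w) (leqnn _); rewrite -(size_swap w p q) take_size take_oversize // size_swap ltnW.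
have ce' : count_mem e.+1 (take t w) = 0.
  by apply/eqP; rewrite -leqn0 -ce -{2}(cat_take_drop t w) count_cat leq_addr.
have := count_take_swap x pq' wp wq tw; have := count_take_swap x.+1 pq' wp wq tw.
have := bw t x; have h : (q < t) <= (p < t).
  by case: (ltnP q t) => // /(ltn_trans pq) ->.
have [ex|ex] := eqVneq e x.
  rewrite -ex ce' (ltn_eqF e_gt0) (ltn_eqF (ltnSn e)); lia.
case: (eqVneq e x.+1); case: (eqVneq 0 x); lia.
Qed.

Lemma swap_inj w1 w2 p q : size w1 = size w2 ->
  nth 0 w1 p = nth 0 w2 p -> nth 0 w1 q = nth 0 w2 q ->
  swap w1 p q = swap w2 p q -> w1 = w2.
Proof.
move=> sw ep eq es; apply: (@eq_from_nth _ 0) => // r rw.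
have := congr1 (fun v => nth 0 v r) es; rewrite !nth_swap // -?sw //.
by have [->|_] := eqVneq r p; last by have [->|_] := eqVneq r q.
Qed.

End Swap.

(** * Comparison of neighbouring atoms by counting exchanges *)

Section SwapCount.
Local Open Scope nat_scope.
Variables (d e k n : nat) (c : nat -> nat).
Hypotheses (e_gt0 : 0 < e) (de : d = e.+1) (pc : part d c)
  (cn : \sum_(i < d) c i = n) (kc : k <= c 0 + c e).

Definition num_early j := count (fun w => count_mem e (early e k w) == j) (words d n c).

(* Exchanging a letter e among the first k stars with a letter 0 among the
   later ones moves a row-0 entry forward and a last-row entry backward, which
   preserves the ballot condition. Counting the pairs to be exchanged before
   and after gives the inequality. *)
Lemma num_early_swap j :
  num_early j.+1 * (j.+1 * (c 0 - (k - j.+1))) <=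
  num_early j * ((k - j) * (c e - j)).
Proof.
have wP w : w \in words d n c ->
    [/\ ballot w, forall x, count_mem x w = c x & size w = n].
  by move=> ww; have [bw cw] := (mem_words _ pc cn).1 ww; rewrite (size_mem_words ww).
have early0 w : w \in words d n c ->
    count_mem 0 (early e k w) = k - count_mem e (early e k w).
  move=> /wP [_ cw _]; have := count_early_star k e_gt0 w.
  by rewrite count_star // !cw (minn_idPl kc); lia.
pose cond p q w := [&& count_mem e (early e k w) == j.+1,
  (rank e w p < k) && (nth 0 w p == e) & (k <= rank e w q) && (nth 0 w q == 0)].
pose cond' p q w := [&& count_mem e (early e k w) == j,
  (rank e w p < k) && (nth 0 w p == 0) & (k <= rank e w q) && (nth 0 w q == e)].
(* For fixed positions the exchange is an injection from the words counted by [cond p q] into those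
   counted by [cond' p q]. *)
have le p q : p < n -> q < n -> 
    count (cond p q) (words d n c) <= count (cond' p q) (words d n c).
  move=> pn qn; rewrite -!size_filter -(size_map (fun w => swap e w p q)).
  apply: uniq_leq_size.
    rewrite map_inj_in_uniq ?filter_uniq ?words_uniq // => w1 w2.
    rewrite !mem_filter => /andP[/and3P[_ /andP[_ /eqP a1] /andP[_ /eqP a2]] w1w].
    move=> /andP[/and3P[_ /andP[_ /eqP b1] /andP[_ /eqP b2]] w2w].
    have [_ _ s1] := wP _ w1w; have [_ _ s2] := wP _ w2w.
    by apply: swap_inj; rewrite ?s1 ?s2 ?a1 ?a2 ?b1 ?b2.
  move=> v /mapP[w]; rewrite mem_filter.
  move=> /andP[/and3P[/eqP hj /andP[rp /eqP wp] /andP[rq /eqP wq]] ww] ->.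
  have [bw cw sw] := wP _ ww.
  have pq : p < q by apply: (@rank_lt e w); exact: leq_trans rp rq.
  have pq' : p != q by rewrite ltn_eqF.
  have qw : q < size w by rewrite sw.
  have pw : p < size w by rewrite sw.
  rewrite mem_filter /cond' !rank_swap // ?(ltnW pw) ?(ltnW qw) // rp rq.
  rewrite !nth_swap // !eqxx [q == p]eq_sym (negPf pq') !andbT.
  rewrite -(eqn_add2l 1) !add1n swap_early // hj !eqxx /=.
  apply: (mem_words _ pc cn).2; split.
    apply: swap_ballot => //; rewrite cw; apply: part_ge_eq0 pc _.
    by rewrite de.
  move=> x; rewrite -cw; have := count_take_swap e_gt0 x pq' wp wq (leqnn _).
  by rewrite pw qw -{1}(size_swap e w p q) !take_size; lia.
have {}le : \sum_(0 <= p < n) \sum_(0 <= q < n) count (cond p q) (words d n c) <=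
    \sum_(0 <= p < n) \sum_(0 <= q < n) count (cond' p q) (words d n c).
  rewrite big_nat [leqRHS]big_nat; apply: leq_sum => p /andP[_ pn].
  by rewrite big_nat [leqRHS]big_nat; apply: leq_sum => q /andP[_ qn]; exact: le.
(* Summing over positions first, the number of admissible pairs in a word is the number of early
   letters [x] times the number of late letters [y]. *)
have E (i x y : nat) : \sum_(0 <= p < n) \sum_(0 <= q < n)
    count (fun w => [&& count_mem e (early e k w) == i,
     (rank e w p < k) && (nth 0 w p == x) & (k <= rank e w q) && (nth 0 w q == y)])
      (words d n c) =
   \sum_(w <- words d n c | count_mem e (early e k w) == i)
     (\sum_(0 <= p < n) (rank e w p < k) * (nth 0 w p == x)) *
     (\sum_(0 <= q < n) (k <= rank e w q) * (nth 0 w q == y)).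
  under eq_bigr do under eq_bigr do rewrite -sum1_count big_mkcond.
  under eq_bigr do rewrite exchange_big; rewrite exchange_big [RHS]big_mkcond.
  apply: eq_bigr => w _ /=; case: eqP => _ /=; last first.
    by rewrite big1 // => p _; rewrite big1.
  rewrite big_distrlr /=; apply: eq_bigr => p _; apply: eq_bigr => q _.
  by rewrite !mulnb; case: ifP.
move: le; rewrite !E => le.
have F i x y B : (forall w, w \in words d n c -> count_mem e (early e k w) = i ->
     (\sum_(0 <= p < n) (rank e w p < k) * (nth 0 w p == x)) *
     (\sum_(0 <= q < n) (k <= rank e w q) * (nth 0 w q == y)) = B) ->
   \sum_(w <- words d n c | count_mem e (early e k w) == i)
     (\sum_(0 <= p < n) (rank e w p < k) * (nth 0 w p == x)) *
     (\sum_(0 <= q < n) (k <= rank e w q) * (nth 0 w q == y)) = num_early i * B.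
  move=> H; rewrite big_seq_cond (eq_bigr (fun=> B)) => [|w /andP[ww /eqP]]; last exact: H.
  by rewrite -big_seq_cond big_const_seq iter_addn_0 mulnC.
move: le; rewrite (F j.+1 e 0 (j.+1 * (c 0 - (k - j.+1)))).
  rewrite (F j 0 e ((k - j) * (c e - j))) // => w ww hw; have [_ cw sw] := wP _ ww.
  rewrite -{1 2}sw -count_0_early // early0 // hw; congr (_ * _).
  by rewrite count_late // cw -count_e_early hw.
move=> w ww hw; have [_ cw sw] := wP _ ww.
rewrite -{1 2}sw -count_e_early hw; congr (_ * _).
by rewrite count_late // cw -count_0_early early0 // hw.
Qed.

End SwapCount.

(** * Positions of letters and the order of two cells *)

Section Positions.
Local Open Scope nat_scope.
Implicit Types (w : seq nat).

Lemma count_takeS w p x : p < size w -> nth 0 w p = x ->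
  count_mem x (take p.+1 w) = (count_mem x (take p w)).+1.
Proof. by move=> pw wp; rewrite (take_nth 0) // -cats1 count_cat /= wp eqxx addn1. Qed.

Lemma position_uniq w p q x : p < size w -> q < size w ->
  nth 0 w p = x -> nth 0 w q = x ->
  count_mem x (take p w) = count_mem x (take q w) -> p = q.
Proof.
move=> pw qw wp wq pq; case: (ltngtP p q) => // lt.
  by have := leq_count_take (pred1 x) w lt; rewrite (count_takeS pw wp) pq ltnn.
by have := leq_count_take (pred1 x) w lt; rewrite (count_takeS qw wq) pq ltnn.
Qed.

Lemma position_exists w x j : j < count_mem x w ->
  exists p, [/\ p < size w, nth 0 w p = x & count_mem x (take p w) = j].
Proof.
elim: w j => //= y w IH j; have [->|yx] := eqVneq y x.
  case: j => [_|j]; first by exists 0; rewrite take0.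
  rewrite add1n ltnS => /IH[p [pw wp cp]]; exists p.+1; split=> //=.
  by rewrite eqxx cp.
rewrite add0n => /IH[p [pw wp cp]]; exists p.+1; split=> //=.
by rewrite (negPf yx) cp.
Qed.

(** With [a] and [b] counted from 0, the relevant number of stars is [(a + b).+1]: these stars
    contain either more than [a] letters [0] or more than [b] letters [e], never both, and this
    decides which of the two positions comes first. *)
Lemma position_ltE e w p q a b : 0 < e -> p < size w -> q < size w ->
  nth 0 w p = 0 -> nth 0 w q = e ->
  count_mem 0 (take p w) = a -> count_mem e (take q w) = b ->
  (p < q) = (count_mem e (early e (a + b).+1 w) <= b).
Proof.
move=> e0 pw qw wp wq ca cb.
have pS := count_takeS pw wp; have qS := count_takeS qw wq.
rewrite ca cb in pS qS.
have leT x t : count_mem x (take t w) <= count_mem x w.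
  by rewrite -{2}(cat_take_drop t w) count_cat leq_addr.
have sw : (a + b).+1 <= count (star e) w.
  by rewrite count_star //; have := leT 0 p.+1; have := leT e q.+1; lia.
have se : star e e by rewrite /star eqxx orbT.
have pq : p != q.
  by apply: contraTneq e0 => pq; move: wq; rewrite -pq wp => <-.
have := count_early_star (a + b).+1 e0 w; rewrite (minn_idPl sw) => hs.
apply/idP/idP => [{}pq|H].
  rewrite leqNgt; apply/negP => H.
  have : count_mem 0 (early e (a + b).+1 w) <= a by lia.
  have e0' : e != 0 by rewrite -lt0n.
  move=> /(early_or e0 p.+1 se (isT : star e 0) e0' sw)[]; last by lia.
  have : count_mem e (take p.+1 w) <= count_mem e (take q w).
    exact: leq_count_take.
  by lia.
rewrite ltn_neqAle pq leqNgt; apply/negP => {}pq.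
have e0' : 0 != e by rewrite eq_sym -lt0n.
have [] := early_or e0 q.+1 (isT : star e 0) se e0' sw H; last by lia.
have : count_mem 0 (take q.+1 w) <= count_mem 0 (take p w).
  exact: leq_count_take.
by lia.
Qed.

End Positions.

(** * Linear extensions as ballot words *)

Section Tableaux.
Local Open Scope nat_scope.
Variables (n : nat) (lam : seq nat).
Hypothesis lamP : is_partition n lam.
Local Notation d := (size lam).
Local Notation c := (nth 0 lam).
Local Notation T := (young lam : finPOrderType young_display).
Implicit Types (L : {ffun T -> 'I_#|T|}) (x y : T).

Lemma part_nth : part d c.
Proof.
split; last by rewrite nth_default.
case/and3P: lamP => /(sortedP 0) sl _ _ i.
case: (ltnP i.+1 d) => [|di]; first exact: sl.
by rewrite nth_default.
Qed.

Lemma sum_nth : \sum_(i < d) c i = n.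
Proof. by case/and3P: lamP => _ _ /eqP <-; rewrite sumnE (big_nth 0) big_mkord. Qed.

Lemma card_young : #|T| = n.
Proof. by rewrite -sum_nth; exact: tagnat.card. Qed.

Definition cell (i : 'I_d) (j : 'I_(c i)) : T := existT _ i j.

Lemma young_inj x y : young_row x = young_row y -> young_col x = young_col y -> x = y.
Proof.
by move=> xy1 xy2; apply: young_le_anti; rewrite /young_le xy1 xy2 !leqnn.
Qed.

Definition reading L : seq nat :=
  [seq (if [pick x | L x == t] is Some x then young_row x else 0) | t <- enum 'I_#|T|].

Lemma size_reading L : size (reading L) = n.
Proof. by rewrite size_map size_enum_ord card_young. Qed.

Lemma nth_reading L x : injective L -> nth 0 (reading L) (L x) = young_row x.
Proof.
move=> iL; rewrite (nth_map (L x)) ?size_enum_ord // nth_ord_enum.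
by case: pickP => [y /eqP/iL ->|/(_ x)] //; rewrite eqxx.
Qed.

Lemma count_reading L (i s : nat) : bijective L -> s <= n ->
  count_mem i (take s (reading L)) = \sum_(x : T | young_row x == i) (L x < s).
Proof.
move=> bL sn; have iL := bij_inj bL.
rewrite count_take_sum ?size_reading //.
rewrite (big_nat_widen _ _ n) // -{1}card_young big_mkord.
rewrite (reindex L) /=; last by case: bL => g gL Lg; exists g => z _.
rewrite big_mkcond [RHS]big_mkcond /=; apply: eq_bigr => x _.
by rewrite nth_reading //; case: ltnP; case: eqVneq.
Qed.

Lemma count_reading_row L (i : 'I_d) s : bijective L -> s <= n ->
  count_mem (i : nat) (take s (reading L)) = \sum_(j < c i) (L (cell j) < s).
Proof.
move=> bL sn; rewrite count_reading //.
have -> : \sum_(j < c i) (L (cell j) < s) =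
    \sum_(i' < d | i' == i) \sum_(j < c i') (L (cell j) < s) by rewrite big_pred1_eq.
rewrite (sig_big_dep _ _ (fun (i' : 'I_d) (j : 'I_(c i')) => nat_of_bool (L (cell j) < s))) /=.
apply: eq_big => [[i' j]|[i' j]] //.
by rewrite andbT /young_row /= -val_eqE.
Qed.

(** Labels increase along a row, so the cells of that row with smaller labels are exactly those to
    the left. A cell is thereby recovered from its position in the word. *)
Lemma count_reading_cell L x : L \in lin_ext T ->
  count_mem (young_row x) (take (L x) (reading L)) = young_col x.
Proof.
case/lin_extP=> bL mL; case: x => i j.
have Ln : L (existT _ i j) <= n by rewrite -[X in _ <= X]card_young ltnW.
rewrite (count_reading_row i bL Ln).
have lt (j1 j2 : 'I_(c i)) : j1 < j2 -> L (cell j1) < L (cell j2).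
  move=> j12; apply: mL; rewrite lt_neqAle; apply/andP; split.
    apply: contraTneq j12 => /(congr1 (@young_col lam)).
    by rewrite /young_col /= => ->; rewrite ltnn.
  by apply/andP; rewrite /young_row /young_col /= leqnn ltnW.
rewrite (eq_bigr (fun j' : 'I_(c i) => nat_of_bool (j' < j))) => [|j' _].
  rewrite -(big_mkord xpredT (fun j' => nat_of_bool (j' < j))).
  rewrite (big_cat_nat (n := j)) ?(ltnW (ltn_ord j)) //=.
  rewrite [X in _ + X]big_nat_cond [X in _ + X]big1 ?addn0.
    rewrite big_nat_cond (eq_bigr (fun=> 1)); last by move=> j' /andP[/andP[_ ->]].
    by rewrite -big_nat_cond sum_nat_const_nat subn0 muln1.
  by move=> j' /andP[/andP[jj' _] _]; rewrite ltnNge jj'.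
congr nat_of_bool; apply/idP/idP; last exact: lt.
apply: contraTT; rewrite -!leqNgt leq_eqVlt => /predU1P[jj|/lt/ltnW//].
by have -> : j' = j by exact/val_inj.
Qed.

(** The ballot condition comes from the columns: the cell above a cell of row [i.+1] has a smaller
    label. *)
Lemma reading_words L : L \in lin_ext T -> reading L \in words d n c.
Proof.
move=> l; have /lin_extP[bL mL] := l.
apply: (mem_words _ part_nth sum_nth).2.
have big i s : d <= i -> s <= n -> count_mem i (take s (reading L)) = 0.
  move=> di sn; rewrite count_reading // big1 // => x /eqP xi.
  by have := ltn_ord (tag x); rewrite -[nat_of_ord _]/(young_row x) xi ltnNge di.
split=> [s i|i]; last first.
  rewrite -(take_size (reading L)) size_reading.
  case: (ltnP i d) => [id|di]; last by rewrite big // nth_default.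
  rewrite (count_reading_row (Ordinal id)) // (eq_bigr (fun=> 1)).
    by rewrite sum_nat_const card_ord muln1.
  by move=> j _; rewrite -[X in _ < X]card_young ltn_ord.
wlog sn : s / s <= n => [H|].
  case: (leqP s n) => [|ns]; first exact: H.
  have := H n (leqnn _); rewrite -(size_reading L) take_size.
  by rewrite take_oversize // size_reading ltnW.
case: (ltnP i.+1 d) => [id|di]; last by rewrite big.
rewrite (count_reading_row (Ordinal id)) // (count_reading_row (Ordinal (ltnW id))) //=.
have ci : c i.+1 <= c i by case: part_nth.
rewrite [leqRHS](bigID (fun j : 'I_(c i) => j < c i.+1)) /=.
apply: leq_trans (leq_addr _ _).
rewrite big_ord_narrow; apply: leq_sum => j _.
set x := cell (j : 'I_(c (Ordinal id))); set y := cell (_ : 'I_(c (Ordinal (ltnW id)))).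
suff /mL xy : (y < x)%O by case: (ltnP (L x)) => // xs; rewrite (ltn_trans xy xs).
rewrite lt_neqAle; apply/andP; split.
  apply/eqP => /(congr1 (@young_row lam)) /eqP /=.
  by rewrite /young_row /= ltn_eqF.
by apply/andP; rewrite /young_row /young_col /= leqnSn leqnn.
Qed.

Lemma reading_inj : {in lin_ext T &, injective reading}.
Proof.
move=> L1 L2 l1 l2 e; apply/ffunP => x; apply/val_inj.
have /lin_extP[b1 _] := l1; have /lin_extP[b2 _] := l2.
apply: (@position_uniq (reading L1) _ _ (young_row x)).
- by rewrite size_reading -card_young; exact: ltn_ord.
- by rewrite size_reading -card_young; exact: ltn_ord.
- by rewrite nth_reading //; exact: bij_inj.
- by rewrite e nth_reading //; exact: bij_inj.
- by rewrite count_reading_cell // e count_reading_cell.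
Qed.

(** The cell in row [i] and column [j] is labelled by the position of letter [i] number [j], counted
    from 0; such a position always exists, so the default [enum_rank x] never occurs. *)
Lemma reading_surj w : w \in words d n c -> exists2 L, L \in lin_ext T & reading L = w.
Proof.
move=> ww; have [bw cw] := (mem_words _ part_nth sum_nth).1 ww.
have sw := size_mem_words ww.
pose P x (p : 'I_#|T|) := (nth 0 w p == young_row x) &&
   (count_mem (young_row x) (take p w) == young_col x).
pose L : {ffun T -> 'I_#|T|} := [ffun x => odflt (enum_rank x) [pick p | P x p]].
have LP x : P x (L x).
  rewrite ffunE; case: pickP => //= no.
  have := @position_exists w (young_row x) (young_col x).
  rewrite cw; case: x no => i j no /(_ (ltn_ord j)) [p [pw wp cp]].
  have pT : p < #|T| by rewrite card_young -sw.
  by have := no (Ordinal pT); rewrite /P /= wp cp !eqxx.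
have nL x : nth 0 w (L x) = young_row x by have /andP[/eqP] := LP x.
have cL x : count_mem (young_row x) (take (L x) w) = young_col x.
  by have /andP[_ /eqP] := LP x.
have sL x : L x < size w by rewrite sw -card_young.
have iL : injective L.
  move=> x y xy; have rxy : young_row x = young_row y by rewrite -!nL xy.
  by apply: young_inj => //; rewrite -!cL xy rxy.
have bL : bijective L by apply: inj_card_bij iL _; rewrite card_ord.
exists L.
  apply/lin_extP; split=> // x y xy; rewrite ltnNge; apply/negP.
  rewrite leq_eqVlt => /predU1P[/val_inj/iL yx|yx].
    by move: xy; rewrite yx ltxx.
  (* If [y] came first, the prefix through [L y] would contain more than [young_col y] letters of
     the row of [y], hence by the ballot condition as many of the row of [x], although at most
     [young_col x] of these precede [L x]. *)
  have /andP[rxy cxy] := ltW xy.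
  have row_le i j t : i <= j -> count_mem j (take t w) <= count_mem i (take t w).
    elim: j => [|j IH]; first by rewrite leqn0 => /eqP->.
    rewrite leq_eqVlt => /predU1P[->//|ij]; exact: leq_trans (bw t j) (IH ij).
  have h1 := row_le _ _ (L y).+1 rxy.
  rewrite (count_takeS (sL y) (nL y)) cL in h1.
  have h2 : count_mem (young_row x) (take (L y).+1 w) <=
            count_mem (young_row x) (take (L x) w) by exact: leq_count_take.
  rewrite cL in h2; by have := leq_ltn_trans cxy (leq_trans h1 h2); rewrite ltnn.
apply: (@eq_from_nth _ 0); first by rewrite size_reading.
move=> t; rewrite size_reading -{1}card_young => tT.
case: bL => g _ gL.
by rewrite -[t]/(nat_of_ord (Ordinal tT)) -[Ordinal tT]gL nL nth_reading.
Qed.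

Lemma card_lin_ext_reading (P : pred (seq nat)) :
  #|[set L in lin_ext T | P (reading L)]| = count P (words d n c).
Proof.
have pw : perm_eq [seq reading L | L <- enum (lin_ext T)] (words d n c).
  apply: uniq_perm; last 1 first.
  - move=> w; apply/mapP/idP => [[L]|/reading_surj[L l <-]].
      by rewrite mem_enum => l ->; exact: reading_words.
    by exists L => //; rewrite mem_enum.
  - rewrite map_inj_in_uniq ?enum_uniq // => L1 L2.
    by rewrite !mem_enum; exact: reading_inj.
  - exact: words_uniq.
rewrite -(permP pw) count_map -size_filter cardE; apply: perm_size.
apply: uniq_perm => [||L]; [exact: enum_uniq|exact/filter_uniq/enum_uniq|].
by rewrite mem_enum mem_filter mem_enum !inE andbC.
Qed.

Lemma delta_le_early (R : realType) (a b e : nat) : 0 < e -> d = e.+1 ->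
  a < c 0 -> b < c e ->
  (delta T R <= `|2 * (count (fun w => count_mem e (early e (a + b).+1 w) <= b)%N
                 (words d n c))%:R - (size (words d n c))%:R|
    / (size (words d n c))%:R)%R.
Proof.
move=> e0 de ac bc.
have d0 : 0 < d by rewrite de.
have ed : e < d by rewrite de.
pose x := cell (i := Ordinal d0) (Ordinal ac).
pose y := cell (i := Ordinal ed) (Ordinal bc).
have xy : x != y.
  apply/eqP => /(congr1 (@young_row lam)); rewrite /young_row /= => e0'.
  by rewrite -e0' in e0.
have [_ /(_ _ _ xy) dxy] := delta_min R xy; apply: le_trans dxy _.
set A := count _ _; set N := size _.
have cN : #|lin_ext T| = N.
  rewrite -[RHS](count_predT) -card_lin_ext_reading; apply: eq_card => L.
  by rewrite !inE andbT.
have LA L : L \in lin_ext T ->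
    (L x < L y) = (count_mem e (early e (a + b).+1 (reading L)) <= b).
  move=> l; have /lin_extP[/bij_inj iL _] := l.
  have Ln z : L z < size (reading L) by rewrite size_reading -card_young ltn_ord.
  apply: position_ltE => //; rewrite ?nth_reading //.
    exact: (count_reading_cell x l).
  exact: (count_reading_cell y l).
have cA : #|[set L in lin_ext T | L x < L y]| = A.
  rewrite /A -card_lin_ext_reading; apply: eq_card => L.
  by rewrite in_set [RHS]in_set; case: (boolP (L \in lin_ext T)) => //= /LA.
have cB : #|[set L in lin_ext T | L y < L x]| + A = N.
  rewrite -cA -cN addnC.
  rewrite -(cardsID [set L : {ffun T -> 'I_#|T|} | L x < L y] (lin_ext T)).
  congr (_ + _); apply: eq_card => L; rewrite !inE //.
  case: (boolP (L \in lin_ext T)) => l; have := l; rewrite inE => l'.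
    have /lin_extP[/bij_inj iL _] := l.
    rewrite l' andbT -leqNgt [RHS]leq_eqVlt; case: eqP => // /val_inj/iL e'.
    by rewrite e' eqxx in xy.
  by rewrite (negPf l') andbF.
rewrite /delta_pair /pr_lt cA cN /= -mulrBl normrM [X in (_ * X)%R]ger0_norm ?invr_ge0 //.
rewrite ler_wpM2r ?invr_ge0 // -cB natrD.
by rewrite le_eqVlt; apply/orP; left; apply/eqP; congr `|_|%R; ring.
Qed.

End Tableaux.

(** * The median *)

Lemma size_words_gt0 d n c : part d c -> (\sum_(i < d) c i)%N = n ->
  (0 < size (words d n c))%N.
Proof.
move=> pc cn; rewrite -(ltr_nat rat) (size_words rat pc cn).
have h0 v : part d v -> 0 < hook_prod rat d v.
  move=> pv; apply: divr_gt0; first exact/vdm_gt0/ell_gapped.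
  by apply: prodr_gt0 => i _; rewrite ltr0n fact_gt0.
apply: divr_gt0; last by apply: h0.
by apply: mulr_gt0; [rewrite ltr0n fact_gt0|exact: h0].
Qed.

(** Used with [l = c 0], [h = c e]. Writing [B = (K + 2) * r], the two coefficients of the exchange
    inequality lie on either side of [(h / 2 - B) (l / 2 - B)] and [(h / 2 + B) (l / 2 + B)], whose
    ratio is at least [1 - t] once [8 B <= t h]. Passing from [K + 1] to [K + 2] absorbs a unit, as
    [1 <= r]. *)
Lemma swap_ratio_bound (R : realFieldType) (K t r l h kk jj u u' : R) :
  0 <= K -> 1 <= r -> 0 <= u -> 0 <= u' ->
  kk * 2 <= l + h -> h <= l -> jj + 1 <= kk -> jj + 1 <= h ->
  h / 2 - (K + 1) * r <= jj + 1 ->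
  (K + 2) * r <= h / 2 -> 8 * (K + 2) * r <= t * h ->
  u' * ((jj + 1) * (l - (kk - (jj + 1)))) <= u * ((kk - jj) * (h - jj)) ->
  (1 - t) * u' <= u.
Proof.
move=> K0 r1 u0 u1 k1 ca jk jc jH Hr tH main.
have Kr : 0 <= K * r by rewrite mulr_ge0 //; lra.
have [B BE] : exists B, B = (K + 2) * r by eexists.
have B0 : 0 < B by lra.
have {}Hr : B <= h / 2 by lra.
have {}tH : 8 * B <= t * h by lra.
have {BE}jH : h / 2 - B <= jj by lra.
have lo : (h / 2 - B) * (l / 2 - B) <= (jj + 1) * (l - (kk - (jj + 1))).
  by apply: ler_pM; lra.
have hi : (kk - jj) * (h - jj) <= (l / 2 + B) * (h / 2 + B).
  by apply: ler_pM; lra.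
have X0 : 0 < (l / 2 + B) * (h / 2 + B) by apply: mulr_gt0; lra.
have h0 : 0 < h by lra.
have t0 : 0 <= t by rewrite -(pmulr_lge0 _ h0); lra.
have th : 4 * B * (l / 2) <= t * (h / 2) * (l / 2) by apply: ler_wpM2r; lra.
have tB : 0 <= t * B * (l / 2 + h / 2 + B).
  by apply: mulr_ge0; [apply: mulr_ge0|]; lra.
have Bh : B * h <= B * l by rewrite ler_pM2l.
have key : (1 - t) * ((l / 2 + B) * (h / 2 + B)) <= (h / 2 - B) * (l / 2 - B).
  by lra.
rewrite -(ler_pM2r X0).
have a1 := ler_wpM2l u1 key; have a2 := ler_wpM2l u1 lo; have a3 := ler_wpM2l u0 hi.
by lra.
Qed.

Section Median.
Variables (R : realFieldType) (d e n : nat) (c : nat -> nat).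
Hypotheses (e_gt0 : (0 < e)%N) (de : d = e.+1) (pc : part d c)
  (cn : (\sum_(i < d) c i)%N = n).
Let k := ((c 0 + c e)./2)%N.

Local Notation W := (words d n c).
Local Notation U := (num_early d e k n c).
Definition num_le z := count (fun w => count_mem e (early e k w) <= z)%N W.

Lemma num_leS z : num_le z.+1 = (num_le z + U z.+1)%N.
Proof.
rewrite /num_le /num_early; elim: (words d n c) => //= w s ->.
move: (count _ s) (count _ s) (count_mem e _) => A B h; clear.
by case: (ltngtP h z.+1); lia.
Qed.

Lemma num_le_size z : (num_le z <= size W)%N.
Proof. exact: count_size. Qed.

Let le_c0 : (c e <= c 0)%N. Proof. exact: (part_le pc). Qed.

Let le_sum : (c 0 + c e <= n)%N.
Proof.
have d0 : (0 < d)%N by rewrite de.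
have ed : (e < d)%N by rewrite de.
rewrite -cn (bigD1 (Ordinal d0)) //= leq_add2l (bigD1 (Ordinal ed)) ?leq_addr //.
by rewrite -val_eqE /= -lt0n.
Qed.

Let k_double : (k * 2 <= c 0 + c e <= k * 2 + 1)%N.
Proof. by clear; rewrite /k; lia. Qed.

Let k_le0 : (k <= c 0)%N.
Proof. by move: k_double le_c0; clear; lia. Qed.

Let k_le_sum : (k <= c 0 + c e)%N.
Proof. exact: leq_trans k_le0 (leq_addr _ _). Qed.

Variable r : R.
Hypotheses (r_gt0 : 0 < r) (r2 : r ^+ 2 = n%:R).

(** Chebyshev's inequality at time [m = n./2]. By [early_or], few early letters [e] force row 0 to
    be too long or row [e] too short at that time, by at least [K r - 1 / 2 >= K r / 2]. *)
Lemma early_tail (K : R) z : (4 <= n)%N -> 1 <= K * r ->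
  8 * moment_const R d < K ^+ 2 -> z%:R <= (c e)%:R / 2 - K * r ->
  (2 * num_le z < size W)%N.
Proof.
move=> n4 Kr KC zH; rewrite -(ltr_nat R) natrM.
set m := (n./2)%N; have mn : (2 <= m <= n)%N.
  by move: n4; rewrite /m; clear; lia.
have m12 : (m * 2 <= n <= m * 2 + 1)%N by rewrite /m; clear; lia.
have {m12} [m1 m2] := andP m12.
have mom := shape_second_moment R pc cn mn.
set s := m%:R / n%:R in mom.
have n0 : 0 < n%:R :> R by rewrite ltr0n (leq_trans _ n4).
have {}m1 : m%:R * 2 <= n%:R :> R by rewrite -natrM ler_nat.
have {}m2 : n%:R <= m%:R * 2 + 1 :> R by rewrite -natrM natr1 ler_nat -addn1.
have k1 : (c 0)%:R + (c e)%:R <= k%:R * 2 + 1 :> R.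
  by rewrite -natrM -natrD natr1 ler_nat -addn1; case/andP: k_double.
have sn : s * n%:R = m%:R by rewrite /s divfK // gt_eqF.
have s0 : 0 <= s by rewrite divr_ge0.
have low w : w \in W -> (count_mem e (early e k w) <= z)%N ->
    (K * r / 2) ^+ 2 <= \sum_(i < d)
      ((count_mem (i : nat) (take m w))%:R - s * (c i)%:R) ^+ 2.
  move=> ww hz; have [bw cw] := (mem_words _ pc cn).1 ww.
  have one i : (i < d)%N ->
     K * r / 2 <= `|(count_mem i (take m w))%:R - s * (c i)%:R| ->
     (K * r / 2) ^+ 2 <= \sum_(i < d)
      ((count_mem (i : nat) (take m w))%:R - s * (c i)%:R) ^+ 2.
    move=> id Ki; rewrite (bigD1 (Ordinal id)) //=.
    apply: (@le_trans _ _ (((count_mem i (take m w))%:R - s * (c i)%:R) ^+ 2)).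
      by rewrite -[leRHS]real_normK ?num_real // lerXn2r ?nnegrE //; lra.
    by rewrite lerDl sumr_ge0 // => j _; rewrite sqr_ge0.
  have se : star e e by rewrite /star eqxx orbT.
  have e0' : 0%N != e by rewrite eq_sym -lt0n.
  have kw : (k <= count (star e) w)%N by rewrite count_star // !cw.
  case: (early_or e_gt0 m (isT : star e 0) se e0' kw hz) => H.
    apply: (one 0%N); first by rewrite de.
    have : k%:R <= (count_mem 0%N (take m w))%:R + z%:R :> R.
      by rewrite -natrD ler_nat.
    have c0 : s * (c 0%N)%:R <= (c 0%N)%:R / 2.
      rewrite mulrC ler_wpM2l //.
      by rewrite /s ler_pdivrMr //; lra.
    by move=> h; apply: le_trans (ler_norm _); lra.
  apply: (one e); first by rewrite de.
  have : (count_mem e (take m w))%:R <= z%:R :> R by rewrite ler_nat.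
  have ce : (c e)%:R / 2 - 1 / 2 <= s * (c e)%:R.
    have : (1 / 2 - s) * (c e)%:R <= (1 / 2 - s) * n%:R.
      apply: ler_wpM2l; last by rewrite ler_nat (leq_trans (leq_addl _ _) le_sum).
      by rewrite subr_ge0 /s ler_pdivrMr //; lra.
    by lra.
  by move=> h; rewrite distrC; apply: le_trans (ler_norm _); lra.
have low' : (num_le z)%:R * (K * r / 2) ^+ 2 <= (size W)%:R * (moment_const R d * n%:R).
  apply: le_trans mom; rewrite /num_le -sum1_count natr_sum mulr_suml.
  rewrite big_seq_cond [leRHS]big_seq [leRHS](bigID (fun w =>
    (count_mem e (early e k w) <= z)%N)) /= -[leLHS]addr0 lerD //.
    by apply: ler_sum => w /andP[ww hz]; rewrite mul1r; exact: low.
  by apply: sumr_ge0 => w _; apply: sumr_ge0 => i _; rewrite sqr_ge0.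
have N0 : 0 < (size W)%:R :> R by rewrite ltr0n size_words_gt0.
(* The 8 in the hypothesis on [K] is 4, from squaring the halved deviation, times 2, from asking for
   less than half of the words. *)
rewrite ltNge; apply/negP => NN.
have h1 : (num_le z)%:R * (K * r / 2) ^+ 2 = (num_le z)%:R * K ^+ 2 * n%:R / 4.
  by rewrite -r2; field.
have h2 : (size W)%:R * K ^+ 2 * n%:R <= 2 * (num_le z)%:R * K ^+ 2 * n%:R.
  by apply: ler_wpM2r => //; apply: ler_wpM2r => //; exact: sqr_ge0.
have h3 : (size W)%:R * n%:R * (8 * moment_const R d) < (size W)%:R * n%:R * K ^+ 2.
  by rewrite ltr_pM2l // mulr_gt0.
by move: low'; rewrite h1; lra.
Qed.

Lemma num_early_step (K t : R) j :
  (j.+1 <= k)%N -> (j.+1 <= c e)%N -> 0 <= K -> 1 <= r ->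
  (c e)%:R / 2 - (K + 1) * r <= j.+1%:R ->
  (K + 2) * r <= (c e)%:R / 2 -> 8 * (K + 2) * r <= t * (c e)%:R ->
  (1 - t) * (U j.+1)%:R <= (U j)%:R.
Proof.
move=> jk jc K0 r1 jH Hr tH.
have := num_early_swap e_gt0 de pc cn k_le_sum j; rewrite -(ler_nat R) !natrM.
rewrite !natrB // -?natr1; [|exact: ltnW|exact: ltnW|exact: leq_trans (leq_subr _ _) k_le0].
move=> main; apply: (swap_ratio_bound (K := K) (r := r)) main => //.
- by rewrite -natrM -natrD ler_nat; case/andP: k_double.
- by rewrite ler_nat.
- by rewrite natr1 ler_nat.
- by rewrite natr1 ler_nat.
- by rewrite natr1.
Qed.

(** The least median, so that strictly less than half of the words lie below it. *)
Lemma median_exists : exists b, [/\ (b <= k)%N, (b <= c e)%N,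
  (size W <= 2 * num_le b)%N & forall z, (z < b)%N -> (2 * num_le z < size W)%N].
Proof.
have all_le z : (forall w, w \in W -> count_mem e (early e k w) <= z)%N ->
    (size W <= 2 * num_le z)%N.
  move=> H; suff -> : num_le z = size W by rewrite mul2n -addnn leq_addr.
  by apply/eqP; rewrite -all_count; apply/allP.
have kz : (size W <= 2 * num_le k)%N.
  apply: all_le => w _; apply: leq_trans (count_size _ _) _.
  by rewrite size_take_min geq_minl.
have cz : (size W <= 2 * num_le (c e))%N.
  apply: all_le => w ww; have [_ cw] := (mem_words _ pc cn).1 ww.
  rewrite -cw; apply: leq_count_subseq.
  exact: subseq_trans (take_subseq _ _) (filter_subseq _ _).
have ex : exists z, (size W <= 2 * num_le z)%N by exists k.
case: (ex_minnP ex) => b bP bmin; exists b; split=> // [||z]; rewrite ?bmin //.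
by rewrite ltnNge => zb; rewrite ltnNge; apply: contra zb => /bmin.
Qed.

(** Each of the [S] atoms just below [b] has at least half the mass of the atom at [b], and the
    [S.+1] atoms are disjoint. *)
Lemma median_atom (K t : R) (S b : nat) : (b <= k)%N -> (b <= c e)%N ->
  0 <= K -> 1 <= r -> (c e)%:R / 2 - K * r <= b%:R ->
  (K + 2) * r <= (c e)%:R / 2 -> 8 * (K + 2) * r <= t * (c e)%:R ->
  0 <= t <= 1 -> S%:R * t <= 1 / 2 -> S%:R <= r -> (S < b)%N ->
  (S.+1%:R / 2 * (U b)%:R : R) <= (size W)%:R.
Proof.
move=> bk bc K0 r1 bH Hr tH /andP[t0 t1] St Sr Sb.
have u0 := ler0n R (U b).
(* Bernoulli's inequality [(1 - t) (1 - s t) >= 1 - (s + 1) t] iterates [num_early_step]. Since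
   [S <= r], moving down from [b] only weakens [K] to [K + 1] in the lower bound on the index. *)
have step s : (s <= S)%N -> (1 - s%:R * t) * (U b)%:R <= (U (b - s)%N)%:R.
  elim: s => [|s IH] sS; first by rewrite mul0r subr0 mul1r subn0.
  have Ej : (b - s)%N = (b - s.+1).+1 by move: sS Sb; clear; lia.
  have := @num_early_step K t (b - s.+1)%N; rewrite -Ej => st.
  have sr : s.+1%:R <= r by apply: le_trans Sr; rewrite ler_nat.
  rewrite -natr1 in sr.
  have {}st := st (leq_trans (leq_subr _ _) bk) (leq_trans (leq_subr _ _) bc) K0 r1.
  have {}st : (1 - t) * (U (b - s)%N)%:R <= (U (b - s.+1)%N)%:R.
    apply: st => //; rewrite natrB; first by lra.
    by move: sS Sb; clear; lia.
  apply: le_trans st; have := IH (ltnW sS).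
  have t1' : 0 <= 1 - t by lra.
  move=> /(ler_wpM2l t1') h; apply: le_trans h; rewrite mulrA.
  apply: ler_wpM2r => //; rewrite -natr1.
  have : 0 <= s%:R * t * t by rewrite !mulr_ge0.
  by lra.
have acc s : (s <= S.+1)%N -> (s%:R / 2 * (U b)%:R + (num_le (b - s)%N)%:R : R) <= (num_le b)%:R.
  elim: s => [|s IH] sS; first by rewrite !mul0r add0r subn0.
  have Ej : (b - s)%N = (b - s.+1).+1 by move: sS Sb; clear; lia.
  have := IH (ltnW sS); rewrite Ej num_leS -Ej natrD.
  have sS' : s%:R * t <= S%:R * t by rewrite ler_wpM2r // ler_nat.
  have := step s sS; have : 1 / 2 * (U b)%:R <= (1 - s%:R * t) * (U b)%:R.
    by apply: ler_wpM2r => //; lra.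
  by rewrite -natr1; lra.
apply: (@le_trans _ _ (num_le b)%:R); last by rewrite ler_nat num_le_size.
by have := acc S.+1 (leqnn _); have := ler0n R (num_le (b - S.+1)%N); lra.
Qed.

End Median.

(** * Choice of the constants and the bound on [delta] *)

Theorem theorem1p3 (R : realType) (d : nat) (eps : R) :
  (2 <= d)%N -> 0 < eps ->
  exists2 C : R, 0 < C &
    forall (n : nat) (lam : seq nat),
      is_partition n lam -> size lam = d ->
      eps * n%:R <= (nth 0%N lam d.-1)%:R ->
      delta (young lam) R <= C / Num.sqrt n%:R.
Proof.
move=> d2 eps0; have Cm0 := moment_const_gt0 R d.
(* [K] is large enough for [8 * moment_const R d < K ^+ 2], and [D] for [8 * (K + 2) <= eps * r] as
   soon as [D <= r]. *)
pose K := 1 + 8 * moment_const R d; pose D := 8 * (K + 2) / eps + 2.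
have K1 : 1 <= K by rewrite /K; lra.
have D0 : 0 < 8 * (K + 2) / eps by rewrite divr_gt0 //; lra.
have D2 : 2 <= D by rewrite /D; lra.
exists (8 * D) => [|n lam lamP sl Hlam]; first by lra.
have n0 : (0 < n)%N.
  case/and3P: (lamP) => _; case: (lam) sl => [d0|x s _]; first by rewrite -d0 in d2.
  by case/andP=> x1 _ /eqP <- /=; rewrite addn_gt0 x1.
set r := Num.sqrt n%:R.
have r0 : 0 < r by rewrite sqrtr_gt0 ltr0n.
have r2 : r ^+ 2 = n%:R by rewrite sqr_sqrtr.
(* For [r < D] the claimed bound exceeds 1, which already bounds [delta]. *)
have [rD|Dr] := ltP r D.
  apply: (@le_trans _ _ 1); first exact: bigmin_le_id.
  by rewrite ler_pdivlMr //; lra.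
pose e := d.-1; have de : size lam = e.+1 by rewrite sl /e prednK // ltnW.
have e0 : (0 < e)%N by rewrite /e -subn1 subn_gt0.
pose c := nth 0%N lam; have pc := part_nth lamP; have cn := sum_nth lamP.
rewrite -/e -/c in Hlam pc cn *.
have erD : 8 * (K + 2) <= eps * r.
  have -> : 8 * (K + 2) = eps * (8 * (K + 2) / eps) by field; rewrite gt_eqF.
  by rewrite ler_pM2l //; move: Dr; rewrite /D; lra.
have Hr2 : eps * r ^+ 2 <= (c e)%:R by rewrite r2.
have erD' : 8 * (K + 2) * r <= (c e)%:R.
  by apply: le_trans Hr2; rewrite expr2 mulrA ler_pM2r.
pose t := 8 * (K + 2) / (eps * r).
have er0 : 0 < eps * r by rewrite mulr_gt0.
have Kr : 2 <= K * r by rewrite -[2]mul1r ler_pM //; lra.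
have [b [bk bc bN bmin]] := median_exists e pc cn.
have bH : (c e)%:R / 2 - K * r <= b%:R.
  rewrite leNgt; apply/negP => bH.
  suff : (2 * num_le (size lam) e n c b < size (words (size lam) n c))%N.
    by rewrite ltnNge bN.
  apply: (early_tail e0 de pc cn r2 (K := K)); last exact: ltW.
  - rewrite -(ler_nat R) -r2; have -> : 4 = 2 ^+ 2 :> R by ring.
    by rewrite lerXn2r ?nnegrE //; lra.
  - by lra.
  - rewrite sl /K expr2; have := mulr_gt0 Cm0 Cm0; lra.
(* The largest scale, up to a constant, for which [S * t <= 1 / 2]: indeed [t = 8 (K + 2) / (eps r)]
   is below [D / r]. *)
pose S := Num.truncn (r / (2 * D)).
have D20 : 0 < 2 * D by lra.
have S1 : S%:R * (2 * D) <= r.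
  by rewrite -ler_pdivlMr // truncn_le // divr_ge0 // ltW.
have S2 : r <= S.+1%:R * (2 * D).
  by rewrite -ler_pdivrMr // ltW // truncnS_gt.
have SD : S%:R <= r.
  by apply: le_trans S1; rewrite ler_peMr //; lra.
(* Since [c e >= 8 (K + 2) r], the median satisfies [b >= (3 K + 8) r], well above [S <= r]. *)
have Sb : (S < b)%N by rewrite -(ltr_nat R); lra.
have atom : S.+1%:R / 2 * (num_early (size lam) e ((c 0 + c e)./2)%N n c b)%:R
    <= (size (words (size lam) n c))%:R :> R.
  apply: (median_atom e0 de pc cn (r := r) (K := K) (t := t)) => //.
  - by lra.
  - by lra.
  - by lra.
  - rewrite /t [leRHS]mulrAC ler_pdivlMr //.
    have -> : 8 * (K + 2) * r * (eps * r) = 8 * (K + 2) * (eps * r ^+ 2) by ring.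
    by apply: ler_wpM2l => //; lra.
  - by rewrite /t divr_ge0 //=; [rewrite ler_pdivrMr // mul1r|lra|lra].
  - rewrite /t mulrA ler_pdivrMr //.
    have : S%:R * (2 * D) * eps <= r * eps by rewrite ler_pM2r.
    have -> : S%:R * (2 * D) * eps = 2 * (S%:R * (8 * (K + 2))) + 4 * S%:R * eps.
      by rewrite /D; field; rewrite gt_eqF.
    have : 0 <= 4 * S%:R * eps by rewrite !mulr_ge0 // ltW.
    by lra.
set N := size (words _ _ _) in bN bmin atom.
have N0 : 0 < N%:R :> R by rewrite ltr0n size_words_gt0.
have b0 : (0 < b)%N by apply: leq_ltn_trans Sb.
have ce0 : (c e <= c 0)%N by apply: (part_le pc).
(* With cells counted from 0, cell [k - b] of the first row and cell [b.-1] of the last give exactly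
   [k] stars in [delta_le_early]. *)
have kE : ((c 0 + c e)./2 - b + b.-1).+1 = ((c 0 + c e)./2)%N.
  by move: b0 bk; clear; lia.
have := @delta_le_early n lam lamP R ((c 0 + c e)./2 - b)%N b.-1 e e0 de.
rewrite -/c kE => /(_ _ _)/le_trans; apply.
- by move: b0 bk ce0; clear; lia.
- by move: b0 bc; clear; lia.
(* Fewer than half of the words lie at or below [b.-1] and at least half at or below [b], so twice
   the former count differs from [N] by at most twice the atom [u]. *)
rewrite -/(num_le (size lam) e n c b.-1) -/N.
have := bmin b.-1; rewrite ltn_predL => /(_ b0); rewrite -(ltr_nat R) natrM => A1.
have := num_leS (size lam) e n c b.-1; rewrite prednK // => A2.
move: bN; rewrite A2 -(ler_nat R) natrM natrD => A3.
set u := (num_early _ _ _ _ _ _)%:R in A3 atom.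
have u0 : 0 <= u by apply: ler0n.
rewrite ler_pdivrMr // ler0_norm; last by lra.
(* As [S.+1 >= r / (2 D)], the atom has relative mass at most [4 D / r]; doubling it gives the
   constant [8 D]. *)
have ru : r * u <= 4 * D * N%:R.
  have : r * u <= S.+1%:R * (2 * D) * u by rewrite ler_wpM2r.
  have : 4 * D * (S.+1%:R / 2 * u) <= 4 * D * N%:R by rewrite ler_wpM2l //; lra.
  by lra.
apply: (@le_trans _ _ (2 * u)); first by lra.
by rewrite mulrAC ler_pdivlMr //; lra.
Qed.
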